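(* Let $\rho^n=\rho_1\otimes\cdots\otimes\rho_n$ and $\sigma^n=\sigma_1\otimes\cdots\otimes\sigma_n$ be two sequences of product states on $\mathcal H^{\otimes n}$, with charges $A_j^{(n)}$, $j=1,\dots,c$. These sequences are asymptotically equivalent if and only if there exist ancillary quantum systems with Hilbert spaces $\mathcal K$ (depending on $n$) of dimension $2^{o(n)}$, with trivial charges $A_j'=0$, states $\omega,\omega'$ on $\mathcal K$, and almost-commuting unitaries $U$ on $\mathcal H^{\otimes n}\otimes\mathcal K$ such that \[ \lim_{n\to\infty}\big\|U(\rho^n\otimes\omega')U^\dagger-\sigma^n\otimes\omega\big\|_1=0. \]
   Context: $\mathcal H$ is a finite-dimensional Hilbert space with Hermitian charges $A_1,\dots,A_c$; $A_j^{(n)}=\sum_{i=1}^n\mathbb1^{\otimes(i-1)}\otimes A_j\otimes\mathbb1^{\otimes(n-i)}$. Two sequences of product states $\rho^n,\sigma^n$ are asymptotically equivalent if $\lim_n\frac1n|S(\rho^n)-S(\sigma^n)|=0$ and $\lim_n\frac1n|\mathrm{Tr}\rho^nA_j^{(n)}-\mathrm{Tr}\sigma^nA_j^{(n)}|=0$ for all $j$. A sequence of unitaries $U$ on $\mathcal H^{\otimes n}\otimes\mathcal K$, with $\mathcal K$ an ancilla of dimension $2^{o(n)}$ carrying charges $A_j'$ with $\|A_j'\|_\infty\le o(n)$, is almost-commuting if $\lim_{n\to\infty}\frac1n\|U(A_j^{(n)}+A_j')-(A_j^{(n)}+A_j')U\|_\infty=0$ for all $j=1,\dots,c$. *)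

(* Defs.v *)
From HB Require Import structures.
From mathcomp Require Import all_boot all_order all_algebra.
From mathcomp Require Import complex mxtens.
From mathcomp Require Import all_classical all_reals all_analysis.

Set Implicit Arguments.
Unset Strict Implicit.
Unset Printing Implicit Defensive.

Import Order.TTheory GRing.Theory Num.Theory numFieldNormedType.Exports.
Local Open Scope classical_set_scope.
Local Open Scope ring_scope.

Section Quantum.
Context {R : realType}.
Local Notation C := R[i].

Definition adj {m n} (X : 'M[C]_(m, n)) : 'M[C]_(n, m) := (map_mx Num.conj X)^T.

Definition is_hermitian {n} (X : 'M[C]_n) : Prop := adj X = X.

Definition is_psd {n} (X : 'M[C]_n) : Prop :=
  forall v : 'cV[C]_n, 0 <= (adj v *m X *m v) 0 0.

Definition is_state {n} (X : 'M[C]_n) : Prop := is_psd X /\ \tr X = 1.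

Definition is_unitary {n} (U : 'M[C]_n) : Prop :=
  adj U *m U = 1%:M /\ U *m adj U = 1%:M.

Definition cabs (z : C) : R := complex.Re `|z|.

Definition vnorm {n} (v : 'cV[C]_n) : R := Num.sqrt (complex.Re ((adj v *m v) 0 0)).

Definition opnorm {m n} (X : 'M[C]_(m, n)) : R :=
  sup [set r : R | exists v : 'cV[C]_n, vnorm v = 1 /\ r = vnorm (X *m v)].

Definition spectrum {n} (X : 'M[C]_n) : seq C :=
  sval (closed_field_poly_normal (char_poly X)).

Definition entropy {n} (rho : 'M[C]_n) : R :=
  - \sum_(l <- spectrum rho)
      (if complex.Re l == 0 then 0 else complex.Re l * ln (complex.Re l)).

Definition trnorm {m n} (X : 'M[C]_(m, n)) : R :=
  \sum_(l <- spectrum (adj X *m X)) Num.sqrt (complex.Re l).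

Fixpoint prodst_rec {d} (rho : nat -> 'M[C]_d) (k : nat) : 'M[C]_(d ^ k.+1) :=
  if k is k'.+1 then rho 0%N *t prodst_rec (fun i => rho i.+1) k' else rho 0%N.

Definition prodst {d} (rho : nat -> 'M[C]_d) (n : nat) : 'M[C]_(d ^ n) :=
  if n is k.+1 return 'M[C]_(d ^ n) then prodst_rec rho k else 1.

(** A^{(n)} = sum_i 1^{(x)(i-1)} (x) A (x) 1^{(x)(n-i)} *)
Fixpoint charge_rec {d} (A : 'M[C]_d) (k : nat) : 'M[C]_(d ^ k.+1) :=
  if k is k'.+1 then A *t (1%:M : 'M[C]_(d ^ k'.+1)) + (1%:M : 'M[C]_d) *t charge_rec A k'
  else A.

Definition charge {d} (A : 'M[C]_d) (n : nat) : 'M[C]_(d ^ n) :=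
  if n is k.+1 return 'M[C]_(d ^ n) then charge_rec A k else 0.

Definition asym_equiv {d c} (A : 'I_c -> 'M[C]_d) (rho sigma : nat -> 'M[C]_d) : Prop :=
  ((fun n : nat => `|entropy (prodst rho n) - entropy (prodst sigma n)| / n%:R)
     @ \oo --> (0 : R)) /\
  forall j : 'I_c,
    (fun n : nat => cabs (\tr (prodst rho n *m charge (A j) n)
                          - \tr (prodst sigma n *m charge (A j) n)) / n%:R)
      @ \oo --> (0 : R).

Definition subexp_dim (k : nat -> nat) : Prop :=
  (fun n : nat => ln ((k n)%:R : R) / n%:R) @ \oo --> (0 : R).

Definition sublinear_charges {c} (k : nat -> nat) (A' : 'I_c -> forall n, 'M[C]_(k n)) : Prop :=
  forall j, (fun n : nat => opnorm (A' j n) / n%:R) @ \oo --> (0 : R).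

Definition almost_commuting {d c} (A : 'I_c -> 'M[C]_d) (k : nat -> nat)
  (A' : 'I_c -> forall n, 'M[C]_(k n)) (U : forall n, 'M[C]_(d ^ n * k n)) : Prop :=
  (forall n, is_unitary (U n)) /\
  forall j : 'I_c,
    (fun n : nat =>
       let T := charge (A j) n *t (1%:M : 'M[C]_(k n))
                + (1%:M : 'M[C]_(d ^ n)) *t A' j n in
       opnorm (U n *m T - T *m U n) / n%:R) @ \oo --> (0 : R).

End Quantum.

(* Main.v *)
Require Import Defs.
From HB Require Import structures.
From mathcomp Require Import all_boot all_order all_algebra.
From mathcomp Require Import fingroup perm complex mxtens.
From mathcomp Require Import all_classical all_reals all_analysis.
From mathcomp Require Import ring lra.
Import Order.TTheory GRing.Theory Num.Theory numFieldNormedType.Exports.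
Set Implicit Arguments.
Unset Strict Implicit.
Unset Printing Implicit Defensive.
Local Open Scope classical_set_scope.
Local Open Scope ring_scope.

(** Converse direction.  Charges are compared by trace-norm duality.  For the entropies no
    Fannes-type inequality is needed: [U] carries the typical subspace of [rho^n], of dimension about
    [exp S(rho^n)], to a subspace of dimension [exp (S(rho^n) + o(n))] which captures almost all of
    [sigma^n (x) omega], whose typical eigenvalues are at most [exp (- S(sigma^n) + o(n))]; hence
    [S(sigma^n) <= S(rho^n) + o(n)], and the roles of [rho] and [sigma] are exchanged by [U^-1].

    Direct direction.  Let [P] be the spectral projector of [\sum_j (A_j^(n) - a_j)^2] on the
    eigenvalues at most [(e n / 4)^2], where [a_j] is the mean charge.  Then
    [|(A_j^(n) - a_j) P| <= e n / 4] although the charges do not commute, so every unitary acting only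
    on the range of [P] almost commutes with the charges.  Variances add over product states, hence by
    Chebyshev's inequality both states are almost supported on [P].  Cutting [rho^n] and [sigma^n]
    down to their typical subspaces and then to [P] gives operators on the range of [P] with nearly
    flat spectra, close to the original ones by gentle measurement.  Tensoring with an embezzling
    state with weights [1 / (j H_N)], [N = exp (o(n))], makes both sorted spectra close to
    [1 / (H_N m)], so a permutation of eigenvectors maps one nearly to the other. *)

(** A typical spectrum is flat only up to factors [exp (o(n))], so permuting eigenvectors alone does
    not match two of them in trace norm. The harmonic weights repair this: for a weight [p] of mass
    about 1, about [1 / (H_N r)] of the products [p i / (H_N j)] exceed [r], whatever [p] is, as
    long as [r] stays in a range of logarithmic length about [ln N]. The leftover at the two ends
    costs a fraction of order [t / ln N], where [exp t] measures the lack of flatness. For accuracy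
    [e] this fixes the scales: [t] of order [e^2 n] and [ln N] about [e n]. Only afterwards is [e]
    sent to 0 along a diagonal sequence. The second obstacle is that [rho^n] and [sigma^n] need not
    commute with [P]. The permuted eigenvectors must nevertheless be split by [P], so that the
    unitary can be completed by the identity off its range. Hence the eigenbases common to [P] and
    to the compressed states, and a permutation that respects both splittings. *)

Local Notation is_unitary := Defs.is_unitary.
Local Notation charge := Defs.charge.

(** * Adjoints, tensor products and spectral decomposition *)

Section Adjoint.
Local Open Scope complex_scope.
Context {R : realType}.
Local Notation C := R[i].
Implicit Types (m n p q : nat) (r : R).

Lemma conjE (z : C) : Num.conj z = conjc z.
Proof. by []. Qed.

Lemma conjC_real (r : R) : Num.conj (r%:C : C) = r%:C.
Proof. exact: conjc_real. Qed.

Lemma adjM m n p (X : 'M[C]_(m, n)) (Y : 'M[C]_(n, p)) :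
  adj (X *m Y) = adj Y *m adj X.
Proof. by rewrite /adj map_mxM trmx_mul. Qed.

Lemma adjK m n (X : 'M[C]_(m, n)) : adj (adj X) = X.
Proof. by apply/matrixP => i j; rewrite !mxE conjCK. Qed.

Lemma adjD m n (X Y : 'M[C]_(m, n)) : adj (X + Y) = adj X + adj Y.
Proof. by rewrite /adj map_mxD linearD. Qed.

Lemma adjN m n (X : 'M[C]_(m, n)) : adj (- X) = - adj X.
Proof. by rewrite /adj map_mxN linearN. Qed.

Lemma adjB m n (X Y : 'M[C]_(m, n)) : adj (X - Y) = adj X - adj Y.
Proof. by rewrite adjD adjN. Qed.

Lemma adj0 m n : adj (0 : 'M[C]_(m, n)) = 0.
Proof. by rewrite /adj map_mx0 trmx0. Qed.

Lemma adjZ m n r (X : 'M[C]_(m, n)) : adj (r%:C *: X) = r%:C *: adj X.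
Proof. by apply/matrixP => i j; rewrite !mxE rmorphM [X in X * _]conjC_real. Qed.

Lemma adj_scalar n r : adj ((r%:C)%:M : 'M[C]_n) = (r%:C)%:M.
Proof. rewrite /adj map_scalar_mx tr_scalar_mx; congr (_%:M); exact: conjC_real. Qed.

Lemma adjmx1 n : adj (1%:M : 'M[C]_n) = 1%:M.
Proof. by rewrite /adj map_mx1 trmx1. Qed.

Lemma adj_tens m n p q (X : 'M[C]_(m, n)) (Y : 'M[C]_(p, q)) :
  adj (X *t Y) = adj X *t adj Y.
Proof. by rewrite /adj map_mxT trmx_tens. Qed.

Definition rdiag n (x : 'I_n -> R) : 'M[C]_n := diag_mx (\row_i (x i)%:C).

Lemma rdiagE n (x : 'I_n -> R) i j : rdiag x i j = (x i)%:C *+ (i == j).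
Proof. by rewrite !mxE. Qed.

Lemma eq_rdiag n (x y : 'I_n -> R) : x =1 y -> rdiag x = rdiag y.
Proof. by move=> e; apply/matrixP => i j; rewrite !rdiagE e. Qed.

Lemma adj_rdiag n (x : 'I_n -> R) : adj (rdiag x) = rdiag x.
Proof.
apply/matrixP => i j; rewrite mxE mxE !rdiagE eq_sym; case: eqP => [->|_]; last by rewrite rmorph0.
exact: conjC_real.
Qed.

Lemma rdiagM n (x y : 'I_n -> R) : rdiag x *m rdiag y = rdiag (fun i => x i * y i).
Proof.
rewrite /rdiag mulmx_diag; congr diag_mx.
by apply/rowP => i; rewrite !mxE rmorphM.
Qed.

Lemma rdiagD n (x y : 'I_n -> R) : rdiag x + rdiag y = rdiag (fun i => x i + y i).
Proof. by apply/matrixP => i j; rewrite mxE !rdiagE rmorphD /= mulrnDl. Qed.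

Lemma rdiagN n (x : 'I_n -> R) : - rdiag x = rdiag (fun i => - x i).
Proof. by apply/matrixP => i j; rewrite mxE !rdiagE rmorphN /= mulNrn. Qed.

Lemma rdiagB n (x y : 'I_n -> R) : rdiag x - rdiag y = rdiag (fun i => x i - y i).
Proof. by rewrite rdiagN rdiagD. Qed.

Lemma rdiag_scalar n r : rdiag (fun _ : 'I_n => r) = (r%:C)%:M.
Proof. by apply/matrixP => i j; rewrite rdiagE mxE. Qed.

Lemma mxtrace_rdiag n (x : 'I_n -> R) : \tr (rdiag x) = (\sum_i x i)%:C.
Proof. by rewrite mxtrace_diag rmorph_sum; apply: eq_bigr => i _; rewrite mxE. Qed.

Lemma rdiag_tens m n (x : 'I_m -> R) (y : 'I_n -> R) :
  rdiag x *t rdiag y =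
  rdiag (fun k => x (mxtens_unindex k).1 * y (mxtens_unindex k).2).
Proof.
apply/matrixP => i j.
case: (mxtens_indexP i) => i1 i2; case: (mxtens_indexP j) => j1 j2.
rewrite tensmxE !rdiagE mxtens_indexK /= (can_eq (@mxtens_indexK m n)) xpair_eqE.
by rewrite rmorphM; case: eqP; case: eqP; rewrite ?(mulr0n, mulr1n, mul0r, mulr0).
Qed.

Lemma tensmxDl m n p q (X Y : 'M[C]_(m, n)) (Z : 'M[C]_(p, q)) :
  (X + Y) *t Z = X *t Z + Y *t Z.
Proof. by apply/matrixP => i j; rewrite !mxE mulrDl. Qed.

Lemma tensmxDr m n p q (X : 'M[C]_(m, n)) (Y Z : 'M[C]_(p, q)) :
  X *t (Y + Z) = X *t Y + X *t Z.
Proof. by apply/matrixP => i j; rewrite !mxE mulrDr. Qed.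

Lemma tensmxNl m n p q (X : 'M[C]_(m, n)) (Z : 'M[C]_(p, q)) :
  (- X) *t Z = - (X *t Z).
Proof. by apply/matrixP => i j; rewrite !mxE mulNr. Qed.

Lemma tensmxNr m n p q (X : 'M[C]_(m, n)) (Z : 'M[C]_(p, q)) :
  X *t (- Z) = - (X *t Z).
Proof. by apply/matrixP => i j; rewrite !mxE mulrN. Qed.

Lemma tensmxBl m n p q (X Y : 'M[C]_(m, n)) (Z : 'M[C]_(p, q)) :
  (X - Y) *t Z = X *t Z - Y *t Z.
Proof. by rewrite tensmxDl tensmxNl. Qed.

Lemma tensmx_scalar1 m n (z : C) : (z%:M : 'M[C]_m) *t (1%:M : 'M[C]_n) = z%:M.
Proof.
apply/matrixP => i j.
case: (mxtens_indexP i) => i1 i2; case: (mxtens_indexP j) => j1 j2.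
rewrite tensmxE !mxE (can_eq (@mxtens_indexK m n)) xpair_eqE.
by case: eqP; case: eqP; rewrite ?(mulr0n, mulr1n, mul0r, mulr0, mulr1).
Qed.

Lemma tensmx11 m n : (1%:M : 'M[C]_m) *t (1%:M : 'M[C]_n) = 1%:M.
Proof. exact: tensmx_scalar1. Qed.

Lemma mxtrace_tens m n (X : 'M[C]_m) (Y : 'M[C]_n) : \tr (X *t Y) = \tr X * \tr Y.
Proof. by rewrite /mxtrace mulr_sum; apply: eq_bigr => i _; rewrite mxE. Qed.

Lemma unitary1 n : is_unitary (1%:M : 'M[C]_n).
Proof. by split; rewrite adjmx1 mul1mx. Qed.

Lemma unitary_adj n (U : 'M[C]_n) : is_unitary U -> is_unitary (adj U).
Proof. by case=> u1 u2; split; rewrite adjK. Qed.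

Lemma unitaryM n (U V : 'M[C]_n) : is_unitary U -> is_unitary V -> is_unitary (U *m V).
Proof.
move=> [u1 u2] [v1 v2]; split; rewrite adjM mulmxA.
  by rewrite -(mulmxA (adj V)) u1 mulmx1.
by rewrite -(mulmxA U) v2 mulmx1.
Qed.

Lemma unitary_tens m n (U : 'M[C]_m) (V : 'M[C]_n) :
  is_unitary U -> is_unitary V -> is_unitary (U *t V).
Proof.
by move=> [u1 u2] [v1 v2]; split; rewrite adj_tens tensmx_mul ?u1 ?u2 ?v1 ?v2 tensmx11.
Qed.

(** Hermitian matrices are carried in this form throughout, so that order relations, norms, traces
    and entropies reduce to statements about the real vector [x]. *)
Definition udiag n (W : 'M[C]_n) (x : 'I_n -> R) := adj W *m rdiag x *m W.

Lemma eq_udiag n (W : 'M[C]_n) (x y : 'I_n -> R) : x =1 y -> udiag W x = udiag W y.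
Proof. by move=> e; rewrite /udiag (eq_rdiag e). Qed.

Lemma adj_udiag n (W : 'M[C]_n) x : adj (udiag W x) = udiag W x.
Proof. by rewrite /udiag !adjM adjK adj_rdiag mulmxA. Qed.

Lemma udiagM n (W : 'M[C]_n) x y : is_unitary W ->
  udiag W x *m udiag W y = udiag W (fun i => x i * y i).
Proof.
move=> [_ w]; rewrite /udiag !mulmxA -(mulmxA _ W) w mulmx1.
by rewrite -(mulmxA (adj W)) rdiagM.
Qed.

Lemma udiagB n (W : 'M[C]_n) x y :
  udiag W x - udiag W y = udiag W (fun i => x i - y i).
Proof. by rewrite /udiag -mulmxBl -mulmxBr rdiagB. Qed.

Lemma udiagD n (W : 'M[C]_n) x y :
  udiag W x + udiag W y = udiag W (fun i => x i + y i).
Proof. by rewrite /udiag -mulmxDl -mulmxDr rdiagD. Qed.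

Lemma udiag_scalar n (W : 'M[C]_n) r : is_unitary W ->
  udiag W (fun=> r) = (r%:C)%:M.
Proof. by move=> [w _]; rewrite /udiag rdiag_scalar scalar_mxC -mulmxA w mulmx1. Qed.

Lemma mxtrace_udiag n (W : 'M[C]_n) x : is_unitary W ->
  \tr (udiag W x) = (\sum_i x i)%:C.
Proof. by move=> [_ w]; rewrite /udiag mxtrace_mulC mulmxA w mul1mx mxtrace_rdiag. Qed.

Lemma udiag_tens m n (W : 'M[C]_m) (V : 'M[C]_n) x y :
  udiag W x *t udiag V y =
  udiag (W *t V) (fun k => x (mxtens_unindex k).1 * y (mxtens_unindex k).2).
Proof. by rewrite /udiag -!tensmx_mul adj_tens rdiag_tens. Qed.

Lemma udiag1 n x : udiag (1%:M : 'M[C]_n) x = rdiag x.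
Proof. by rewrite /udiag adjmx1 mul1mx mulmx1. Qed.

Lemma herm_spectral n (X : 'M[C]_n) : is_hermitian X ->
  exists W (x : 'I_n -> R), is_unitary W /\ X = udiag W x.
Proof.
move=> hX; have hX' : X \is hermsymmx.
  by rewrite qualifE /= expr0 scale1r -[in X in X == _]hX /adj map_trmx.
have /orthomx_spectralP XE := hermitian_normalmx hX'.
have sr := hermitian_spectral_diag_real hX'.
set W := spectralmx X in XE.
have uW : W \is unitarymx := spectral_unitarymx X.
have aW : invmx W = adj W by rewrite invmx_unitary // /adj map_trmx.
exists W, (fun i => complex.Re (spectral_diag X 0 i)); split.
  by split; rewrite -aW ?mulVmx ?mulmxV // unitarymx_unit.
rewrite {1}XE aW /udiag /rdiag; congr (_ *m diag_mx _ *m _).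
by apply/rowP => i; rewrite mxE RRe_real //; exact: (mxOverP sr).
Qed.

End Adjoint.

(** * Positive semidefinite matrices and the real trace pairing *)

Section Positivity.
Local Open Scope complex_scope.
Context {R : realType}.
Local Notation C := R[i].
Implicit Types (m n p q : nat) (r : R).

Lemma psd0 n : is_psd (0 : 'M[C]_n).
Proof. by move=> v; rewrite mulmx0 mul0mx mxE. Qed.

Lemma psdD n (X Y : 'M[C]_n) : is_psd X -> is_psd Y -> is_psd (X + Y).
Proof.
move=> hX hY v; rewrite mulmxDr mulmxDl mxE; exact: addr_ge0 (hX v) (hY v).
Qed.

Lemma psd_sum n (I : Type) (s : seq I) (P : pred I) (F : I -> 'M[C]_n) :
  (forall i, P i -> is_psd (F i)) -> is_psd (\sum_(i <- s | P i) F i).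
Proof. by move=> h; apply: big_ind => //; [exact: psd0|exact: psdD]. Qed.

Lemma psdZ n r (X : 'M[C]_n) : 0 <= r -> is_psd X -> is_psd (r%:C *: X).
Proof.
move=> r0 hX v; rewrite -scalemxAr -scalemxAl mxE mulr_ge0 ?hX //.
by rewrite ler0c.
Qed.

Lemma psd_conj m n (X : 'M[C]_n) (Y : 'M[C]_(n, m)) :
  is_psd X -> is_psd (adj Y *m X *m Y).
Proof. by move=> hX v; have := hX (Y *m v); rewrite adjM !mulmxA. Qed.

Lemma psd1 n : is_psd (1%:M : 'M[C]_n).
Proof.
move=> v; rewrite mulmx1 mxE; apply: sumr_ge0 => i _; rewrite !mxE.
by rewrite mulrC mul_conjC_ge0.
Qed.

Lemma psd_gram m n (Y : 'M[C]_(n, m)) : is_psd (adj Y *m Y).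
Proof. by have := psd_conj Y (@psd1 n); rewrite mulmx1. Qed.

Lemma psd_sqr n (X : 'M[C]_n) : is_hermitian X -> is_psd (X *m X).
Proof. by move=> h; rewrite -{1}h; exact: psd_gram. Qed.

Lemma psd_scalar n r : 0 <= r -> is_psd ((r%:C)%:M : 'M[C]_n).
Proof. by move=> r0; rewrite -scalemx1; apply: psdZ => //; exact: psd1. Qed.

Lemma psd_rdiag n (x : 'I_n -> R) : (forall i, 0 <= x i) -> is_psd (rdiag x).
Proof.
move=> h; have -> : rdiag x = adj (rdiag (Num.sqrt \o x)) *m rdiag (Num.sqrt \o x).
  rewrite adj_rdiag rdiagM; apply: eq_rdiag => i /=.
  by rewrite -expr2 sqr_sqrtr.
exact: psd_gram.
Qed.

Lemma psd_udiag n (W : 'M[C]_n) x : (forall i, 0 <= x i) -> is_psd (udiag W x).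
Proof. by move=> h; apply: psd_conj; exact: psd_rdiag. Qed.

Lemma udiag_coef n (W : 'M[C]_n) x i : is_unitary W ->
  x i = complex.Re ((W *m udiag W x *m adj W) i i).
Proof.
move=> [_ w]; rewrite /udiag !mulmxA w mul1mx -mulmxA w mulmx1.
by rewrite rdiagE eqxx.
Qed.

Lemma form_coef n (X : 'M[C]_n) (W : 'M[C]_n) i :
  (W *m X *m adj W) i i = (adj (adj (row i W)) *m X *m adj (row i W)) 0 0.
Proof.
rewrite adjK !mxE; apply: eq_bigr => k _; rewrite !mxE; congr (_ * _).
by apply: eq_bigr => j _; rewrite !mxE.
Qed.

Lemma psd_udiag_ge0 n (W : 'M[C]_n) x : is_unitary W ->
  is_psd (udiag W x) -> forall i, 0 <= x i.
Proof.
move=> uW h i; rewrite (udiag_coef x i uW) form_coef.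
by have := h (adj (row i W)); rewrite lecE => /andP[].
Qed.

(** A nonnegative complex number is real, so the form of [X] is real. Hence the Hermitian matrix
    [K = i (adj X - X)] has vanishing form, all its eigenvalues are 0, and [K = 0]. *)
Lemma psd_herm n (X : 'M[C]_n) : is_psd X -> is_hermitian X.
Proof.
move=> hX; pose K := 'i *: (adj X - X).
have hK : is_hermitian K.
  apply/matrixP => a b; rewrite /K !mxE rmorphM rmorphB /= conjCK !conjE.
  have -> : conjc ('i : C) = - 'i by apply/eqP; rewrite eq_complex /= oppr0 !eqxx.
  by rewrite mulNr -mulrN opprB.
have [W [k [uW KE]]] := herm_spectral hK.
have k0 i : k i = 0.
  rewrite (udiag_coef k i uW) -KE form_coef /K.
  set v := adj (row i W); rewrite -scalemxAr -scalemxAl mulmxBr mulmxBl mxE.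
  rewrite [X in _ * X]mxE [X in _ * (_ + X)]mxE.
  have -> : adj v *m adj X *m v = adj (adj v *m X *m v) by rewrite !adjM adjK mulmxA.
  rewrite [X in _ * (X - _)]mxE [X in _ * (X - _)]mxE.
  by rewrite geC0_conj ?subrr ?mulr0 //; exact: hX.
have K0 : K = 0.
  rewrite KE /udiag (eq_rdiag k0) rdiag_scalar -scalemx1 scale0r.
  by rewrite mulmx0 mul0mx.
have : ('i : C)^-1 *: K = 0 by rewrite K0 scaler0.
rewrite /K scalerA mulVf ?scale1r; first by move/eqP; rewrite subr_eq0 => /eqP.
by rewrite eq_complex /= oner_eq0 andbF.
Qed.

Lemma psd_spectral n (X : 'M[C]_n) : is_psd X ->
  exists W (x : 'I_n -> R), [/\ is_unitary W, X = udiag W x & forall i, 0 <= x i].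
Proof.
move=> h; have [W [x [uW XE]]] := herm_spectral (psd_herm h).
by exists W, x; split => //; apply: (psd_udiag_ge0 uW); rewrite -XE.
Qed.

Lemma psd_sqrt n (X : 'M[C]_n) : is_psd X -> exists Y : 'M[C]_n, X = adj Y *m Y.
Proof.
move=> /psd_spectral[W [x [uW -> x0]]].
exists (udiag W (Num.sqrt \o x)); rewrite adj_udiag udiagM //.
by apply: eq_udiag => i /=; rewrite -expr2 sqr_sqrtr.
Qed.

Lemma psd_tens m n (X : 'M[C]_m) (Y : 'M[C]_n) :
  is_psd X -> is_psd Y -> is_psd (X *t Y).
Proof.
move=> /psd_sqrt[A ->] /psd_sqrt[B ->].
by rewrite -tensmx_mul -adj_tens; exact: psd_gram.
Qed.

(** Between Hermitian matrices the trace of the product is already real; taking the real part keeps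
    every estimate inside [R]. *)
Definition rtr n (X Y : 'M[C]_n) : R := complex.Re (\tr (X *m Y)).

Lemma ReD (z w : C) : complex.Re (z + w) = complex.Re z + complex.Re w.
Proof. by case: z; case: w. Qed.
Lemma ReN (z : C) : complex.Re (- z) = - complex.Re z.
Proof. by case: z. Qed.
Lemma ReZ r (z : C) : complex.Re (r%:C * z) = r * complex.Re z.
Proof. by case: z => a b /=; rewrite mul0r subr0. Qed.

Lemma rtrC n (X Y : 'M[C]_n) : rtr X Y = rtr Y X.
Proof. by rewrite /rtr mxtrace_mulC. Qed.
Lemma rtrDl n (X Y Z : 'M[C]_n) : rtr (X + Y) Z = rtr X Z + rtr Y Z.
Proof. by rewrite /rtr mulmxDl mxtraceD ReD. Qed.
Lemma rtrDr n (X Y Z : 'M[C]_n) : rtr X (Y + Z) = rtr X Y + rtr X Z.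
Proof. by rewrite rtrC rtrDl !(rtrC X). Qed.
Lemma rtrNl n (X Y : 'M[C]_n) : rtr (- X) Y = - rtr X Y.
Proof. by rewrite /rtr mulNmx linearN ReN. Qed.
Lemma rtrNr n (X Y : 'M[C]_n) : rtr X (- Y) = - rtr X Y.
Proof. by rewrite rtrC rtrNl rtrC. Qed.
Lemma rtrBl n (X Y Z : 'M[C]_n) : rtr (X - Y) Z = rtr X Z - rtr Y Z.
Proof. by rewrite rtrDl rtrNl. Qed.
Lemma rtrBr n (X Y Z : 'M[C]_n) : rtr X (Y - Z) = rtr X Y - rtr X Z.
Proof. by rewrite rtrDr rtrNr. Qed.
Lemma rtrZl n r (X Y : 'M[C]_n) : rtr (r%:C *: X) Y = r * rtr X Y.
Proof. by rewrite /rtr -scalemxAl mxtraceZ ReZ. Qed.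
Lemma rtrZr n r (X Y : 'M[C]_n) : rtr X (r%:C *: Y) = r * rtr X Y.
Proof. by rewrite rtrC rtrZl rtrC. Qed.
Lemma rtr_sumr n (I : Type) (s : seq I) (P : pred I) X (F : I -> 'M[C]_n) :
  rtr X (\sum_(i <- s | P i) F i) = \sum_(i <- s | P i) rtr X (F i).
Proof.
apply: (big_morph (rtr X)); first exact: rtrDr.
by rewrite /rtr mulmx0 mxtrace0.
Qed.
Lemma rtr_scalar n r (X : 'M[C]_n) : rtr X (r%:C)%:M = r * complex.Re (\tr X).
Proof. by rewrite -scalemx1 rtrZr /rtr mulmx1. Qed.

Lemma rtr_ge0 n (X Y : 'M[C]_n) : is_psd X -> is_psd Y -> 0 <= rtr X Y.
Proof.
move=> /psd_sqrt[A ->] hY; rewrite rtrC /rtr mulmxA mxtrace_mulC mulmxA.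
have := psd_conj (adj A) hY; rewrite adjK => /psd_spectral[W [x [uW -> x0]]].
by rewrite mxtrace_udiag //=; apply: sumr_ge0.
Qed.

Lemma rtr_le n (X Y Z : 'M[C]_n) : is_psd X -> is_psd (Z - Y) -> rtr X Y <= rtr X Z.
Proof. by move=> hX h; rewrite -subr_ge0 -rtrBr; exact: rtr_ge0. Qed.

Lemma rtr_udiag n (W : 'M[C]_n) x Y : is_unitary W ->
  rtr (udiag W x) Y = \sum_i x i * complex.Re ((W *m Y *m adj W) i i).
Proof.
move=> uW; rewrite /rtr /udiag -!mulmxA mxtrace_mulC -!mulmxA /mxtrace.
rewrite (big_morph _ ReD (erefl : complex.Re (0 : C) = 0)); apply: eq_bigr => i _.
by rewrite mul_diag_mx !mxE ReZ.
Qed.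

Lemma rtr_conj n (U X Y : 'M[C]_n) : rtr (U *m X *m adj U) Y = rtr X (adj U *m Y *m U).
Proof. by rewrite /rtr -!mulmxA mxtrace_mulC !mulmxA. Qed.

(** Real parts are not multiplicative; Hermitian [X] and [Y] make the first trace real, and then it
    factors out. *)
Lemma rtr_tens m n (X Y : 'M[C]_m) (Z T : 'M[C]_n) :
  is_hermitian X -> is_hermitian Y ->
  rtr (X *t Z) (Y *t T) = rtr X Y * rtr Z T.
Proof.
move=> hX hY; rewrite /rtr tensmx_mul mxtrace_tens.
set a := \tr _; have /RRe_real <- : a \is Num.real; last by rewrite ReZ.
apply/CrealP; rewrite /a /mxtrace rmorph_sum; transitivity (\tr (adj (X *m Y))).
  by apply: eq_bigr => i _; rewrite !mxE.
by rewrite adjM hX hY mxtrace_mulC.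
Qed.

Lemma herm_rtr n (X Y : 'M[C]_n) : is_hermitian X -> is_hermitian Y ->
  \tr (X *m Y) = (rtr X Y)%:C.
Proof.
move=> hX hY; rewrite /rtr RRe_real //.
apply/CrealP; rewrite /mxtrace rmorph_sum; transitivity (\tr (adj (X *m Y))).
  by apply: eq_bigr => i _; rewrite !mxE.
by rewrite adjM hX hY mxtrace_mulC.
Qed.

End Positivity.

(** * Trace norm and operator norm *)

Section Norms.
Local Open Scope complex_scope.
Context {R : realType}.
Local Notation C := R[i].
Implicit Types (m n p q : nat) (r : R).

Lemma char_poly_udiag n (W : 'M[C]_n) x : is_unitary W ->
  char_poly (udiag W x) = \prod_i ('X - ((x i)%:C)%:P).
Proof.
move=> [w1 w2]; rewrite /char_poly /char_poly_mx.
have <- : map_mx polyC (adj W) *m ('X%:M - map_mx polyC (rdiag x)) *m map_mx polyC W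
   = 'X%:M - map_mx polyC (udiag W x).
  rewrite mulmxBr mulmxBl /udiag !map_mxM; congr (_ - _).
  by rewrite scalar_mxC -mulmxA -map_mxM w1 map_mx1 mulmx1.
rewrite !det_mulmx mulrAC -det_mulmx -map_mxM w1 map_mx1 det1 mul1r.
rewrite -[LHS]/(char_poly (rdiag x)) char_poly_trig.
  by apply: eq_bigr => i _; rewrite rdiagE eqxx.
by apply/is_trig_mxP => i j ij; rewrite rdiagE -val_eqE (ltn_eqF ij).
Qed.

(** [spectrum] is some list of roots of the characteristic polynomial, so only its multiset is
    determined; that suffices for the sums defining [entropy] and [trnorm]. *)
Lemma spectrum_udiag n (W : 'M[C]_n) x : is_unitary W ->
  perm_eq (spectrum (udiag W x)) [seq (x i)%:C | i <- index_enum 'I_n].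
Proof.
move=> uW; apply: prod_XsubC_eq; rewrite /spectrum big_map.
case: closed_field_poly_normal => s /= sE.
rewrite -(char_poly_udiag _ uW) sE (monicP (char_poly_monic _)) scale1r //.
Qed.

Lemma entropy_udiag n (W : 'M[C]_n) x : is_unitary W ->
  entropy (udiag W x) = - \sum_i x i * ln (x i).
Proof.
move=> uW; rewrite /entropy (perm_big _ (spectrum_udiag x uW)) big_map; congr (- _).
by apply: eq_bigr => i _ /=; case: eqP => [->|//]; rewrite mul0r.
Qed.

Lemma trnorm_udiag n (W : 'M[C]_n) x : is_unitary W ->
  trnorm (udiag W x) = \sum_i `|x i|.
Proof.
move=> uW; rewrite /trnorm adj_udiag udiagM //.
rewrite (perm_big _ (spectrum_udiag _ uW)) big_map.
by apply: eq_bigr => i _ /=; rewrite -expr2 sqrtr_sqr.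
Qed.

Lemma trnorm_psd n (X : 'M[C]_n) : is_psd X -> trnorm X = complex.Re (\tr X).
Proof.
move=> /psd_spectral[W [x [uW -> x0]]]; rewrite trnorm_udiag // mxtrace_udiag //=.
by apply: eq_bigr => i _; rewrite ger0_norm.
Qed.

Lemma conj_udiag n (U W : 'M[C]_n) x :
  U *m udiag W x *m adj U = udiag (W *m adj U) x.
Proof. by rewrite /udiag adjM adjK !mulmxA. Qed.

Lemma trnorm_conj n (U X : 'M[C]_n) : is_unitary U -> is_hermitian X ->
  trnorm (U *m X *m adj U) = trnorm X.
Proof.
move=> uU /herm_spectral[W [x [uW ->]]].
by rewrite conj_udiag !trnorm_udiag //; apply: unitaryM => //; exact: unitary_adj.
Qed.

Lemma trnorm_tens_rdiag m n (X : 'M[C]_m) (w : 'I_n -> R) :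
  is_hermitian X -> (forall j, 0 <= w j) -> \sum_j w j = 1 ->
  trnorm (X *t rdiag w) = trnorm X.
Proof.
move=> /herm_spectral[W [x [uW ->]]] w0 w1.
rewrite -(udiag1 w) udiag_tens !trnorm_udiag //; last first.
  by apply: unitary_tens => //; exact: unitary1.
rewrite -[RHS]mulr1 -w1 mulr_sum.
by apply: eq_bigr => k _; rewrite normrM (ger0_norm (w0 _)).
Qed.

Lemma psd_coef n (X : 'M[C]_n) i : is_psd X -> 0 <= complex.Re (X i i).
Proof.
move=> hX; have := form_coef X 1%:M i; rewrite adjmx1 mulmx1 mul1mx => ->.
by have := hX (adj (row i 1%:M)); rewrite lecE => /andP[].
Qed.

(** For Hermitian [T] this is the operator norm bound in order form, which passes to sums and tensor
    products without any vectors. *)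
Definition order_bound n r (T : 'M[C]_n) :=
  is_psd ((r%:C)%:M - T) /\ is_psd ((r%:C)%:M + T).

Lemma conj_scalar n r (W : 'M[C]_n) : is_unitary W ->
  W *m (r%:C)%:M *m adj W = (r%:C)%:M.
Proof. by move=> [_ w]; rewrite scalar_mxC -mulmxA w mulmx1. Qed.

(** In an eigenbasis of [X] only the diagonal of [T] enters the trace, and the order bound confines
    it to [[-r, r]]. *)
Lemma trnorm_dual n r (X T : 'M[C]_n) : is_hermitian X -> order_bound r T ->
  `|rtr X T| <= r * trnorm X.
Proof.
move=> /herm_spectral[W [x [uW ->]]] [T1 T2].
rewrite trnorm_udiag // rtr_udiag // mulr_sumr (le_trans (ler_norm_sum _ _ _)) //.
apply: ler_sum => i _; rewrite normrM mulrC ler_wpM2r //.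
have := psd_coef i (psd_conj (adj W) T1); have := psd_coef i (psd_conj (adj W) T2).
rewrite adjK mulmxBr mulmxBl mulmxDr mulmxDl conj_scalar //.
have eD (A B : 'M[C]_n) : complex.Re ((A + B) i i) = complex.Re (A i i) + complex.Re (B i i).
  by rewrite mxE ReD.
have eN (A : 'M[C]_n) : complex.Re ((- A) i i) = - complex.Re (A i i).
  by rewrite mxE ReN.
have er : complex.Re (((r%:C)%:M : 'M[C]_n) i i) = r by rewrite mxE eqxx.
by rewrite !eD eN er ler_norml => h1 h2; lra.
Qed.

Lemma herm_bound_sqr n r (T : 'M[C]_n) : is_hermitian T -> 0 <= r ->
  is_psd (((r ^+ 2)%:C)%:M - T *m T) -> order_bound r T.
Proof.
move=> /herm_spectral[W [t [uW ->]]] r0.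
rewrite (udiagM _ _ uW) -(udiag_scalar (r ^+ 2) uW) udiagB => /(psd_udiag_ge0 uW) h.
rewrite /order_bound -(udiag_scalar r uW) udiagB udiagD.
have {}h i : `|t i| <= r.
  rewrite -ler_sqr ?nnegrE // real_normK ?num_real // -subr_ge0 [t i ^+ 2]expr2.
  exact: h.
by split; apply: psd_udiag => i; move: (h i); rewrite ler_norml => /andP[]; lra.
Qed.

Lemma involution_bound n (G : 'M[C]_n) : is_hermitian G -> G *m G = 1%:M ->
  order_bound 1 G.
Proof.
move=> hG GG; apply: herm_bound_sqr => //.
by rewrite expr1n GG subrr; exact: psd0.
Qed.

Lemma trnorm_attained n (X : 'M[C]_n) : is_hermitian X ->
  exists G : 'M[C]_n, [/\ is_hermitian G, G *m G = 1%:M & rtr X G = trnorm X].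
Proof.
move=> /herm_spectral[W [x [uW ->]]].
(* The value 1, and not 0, at zero eigenvalues makes the sign matrix an exact involution, whence the
   order bound 1. *)
pose s i : R := if 0 <= x i then 1 else -1.
exists (udiag W s); split; first exact: adj_udiag.
  rewrite udiagM // -[1%:M](udiag_scalar 1 uW); apply: eq_udiag => i.
  by rewrite /s; case: ifP => _; rewrite ?mulr1 ?mulrNN ?mulr1.
rewrite trnorm_udiag // /rtr udiagM // mxtrace_udiag //=.
apply: eq_bigr => i _; rewrite /s; case: ifPn => [h|]; first by rewrite ger0_norm ?mulr1.
by rewrite -ltNge => h; rewrite ltr0_norm // mulrN1.
Qed.

(** The sign matrix of the sum attains its norm and is an admissible test for each summand. *)
Lemma trnormD n (X Y : 'M[C]_n) : is_hermitian X -> is_hermitian Y ->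
  trnorm (X + Y) <= trnorm X + trnorm Y.
Proof.
move=> hX hY; have hXY : is_hermitian (X + Y) by rewrite /is_hermitian adjD hX hY.
have [G [hG GG <-]] := trnorm_attained hXY.
rewrite rtrDl; apply: lerD.
  by apply: le_trans (ler_norm _) _; rewrite -[leRHS]mul1r trnorm_dual //;
    exact: involution_bound.
by apply: le_trans (ler_norm _) _; rewrite -[leRHS]mul1r trnorm_dual //;
    exact: involution_bound.
Qed.

(** With [Z = Y *m adj Y], conjugating the hypothesis by [Y] gives [r Z - Z^2 >= 0]; adding
    [(r - Z)^2 >= 0] leaves [r (r - Z) >= 0]. *)
Lemma gram_spectral n (Y : 'M[C]_n) r : 0 < r ->
  is_psd ((r%:C)%:M - adj Y *m Y) -> is_psd ((r%:C)%:M - Y *m adj Y).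
Proof.
move=> r0 h; set Z := Y *m adj Y.
have hZ : is_hermitian Z by rewrite /is_hermitian /Z adjM adjK.
have h1 : is_psd (r%:C *: Z - Z *m Z).
  have := psd_conj (adj Y) h; rewrite adjK mulmxBr mulmxBl.
  by rewrite mul_mx_scalar -scalemxAl /Z !mulmxA.
move: h1 hZ; clearbody Z => h1 hZ.
have h2 : is_psd (((r ^+ 2)%:C)%:M - (2 * r)%:C *: Z + Z *m Z).
  have hK : is_hermitian ((r%:C)%:M - Z) by rewrite /is_hermitian adjB hZ adj_scalar.
  suff -> : ((r ^+ 2)%:C)%:M - (2 * r)%:C *: Z + Z *m Z =
    ((r%:C)%:M - Z) *m ((r%:C)%:M - Z) by exact: psd_sqr.
  rewrite mulmxBr !mulmxBl !mul_scalar_mx mul_mx_scalar scale_scalar_mx.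
  move: (Z *m Z) => Q; apply/matrixP => i j; rewrite !mxE rmorphXn !rmorphM rmorph_nat /=.
  by move: (r%:C) => c; case: (i == j); rewrite ?mulr1n ?mulr0n; ring.
have h3 : (r^-1)%:C *: ((r%:C *: Z - Z *m Z) +
    (((r ^+ 2)%:C)%:M - (2 * r)%:C *: Z + Z *m Z)) = (r%:C)%:M - Z.
  move: (Z *m Z) => Q; apply/matrixP => i j; rewrite !mxE.
  rewrite fmorphV rmorphXn rmorphM rmorph_nat /=.
  have : (r%:C : C) != 0 by rewrite fmorph_eq0 gt_eqF.
  by move: (r%:C) => c c0; case: (i == j); rewrite ?mulr1n ?mulr0n; field.
rewrite -h3; apply: psdZ; first by rewrite invr_ge0 ltW.
exact: psdD.
Qed.

Definition sqn n (v : 'cV[C]_n) : R := complex.Re ((adj v *m v) 0 0).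

Lemma sqnE n (v : 'cV[C]_n) : (adj v *m v) 0 0 = (sqn v)%:C.
Proof.
rewrite /sqn RRe_real // ger0_real //.
by have := @psd1 R n v; rewrite mulmx1.
Qed.

Lemma sqn_ge0 n (v : 'cV[C]_n) : 0 <= sqn v.
Proof. by have := @psd1 R n v; rewrite mulmx1 sqnE ler0c. Qed.

Lemma sqn_eq0 n (v : 'cV[C]_n) : sqn v = 0 -> v = 0.
Proof.
move=> h; have : (adj v *m v) 0 0 = 0 by rewrite sqnE h.
rewrite mxE => /eqP; rewrite psumr_eq0; last first.
  by move=> i _; rewrite !mxE mulrC mul_conjC_ge0.
move=> /allP v0; apply/colP => i; rewrite mxE; apply/eqP.
by have := v0 i (mem_index_enum i); rewrite !mxE mulrC mul_conjC_eq0.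
Qed.

Lemma vnorm_sqr n (v : 'cV[C]_n) : vnorm v ^+ 2 = sqn v.
Proof. by rewrite /vnorm sqr_sqrtr // sqn_ge0. Qed.

Lemma sqnZ n r (v : 'cV[C]_n) : sqn (r%:C *: v) = r ^+ 2 * sqn v.
Proof.
by rewrite /sqn adjZ -scalemxAl -scalemxAr !mxE !ReZ mulrA expr2.
Qed.

Lemma psd_gram_bound m n r (X : 'M[C]_(m, n)) :
  is_psd ((r%:C)%:M - adj X *m X) <-> forall v, sqn (X *m v) <= r * sqn v.
Proof.
have formE (v : 'cV[C]_n) : (adj v *m ((r%:C)%:M - adj X *m X) *m v) 0 0 =
    (r * sqn v - sqn (X *m v))%:C.
  rewrite mulmxBr mulmxBl mul_mx_scalar -scalemxAl !mulmxA -adjM -mulmxA.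
  by rewrite mxE [X in X + _]mxE [X in _ + X]mxE !sqnE rmorphB rmorphM.
split=> h v.
  by have := h v; rewrite formE ler0c subr_ge0.
by rewrite formE ler0c subr_ge0; exact: h.
Qed.

Lemma opnorm_le m n r (X : 'M[C]_(m, n)) : 0 <= r ->
  is_psd (((r ^+ 2)%:C)%:M - adj X *m X) -> opnorm X <= r.
Proof.
move=> r0 /psd_gram_bound h; rewrite /opnorm.
(* In dimension 0 there are no unit vectors, and [sup] of the empty set is 0. *)
set E := [set _ | _]; have [[s Es]|E0] := pselect (E !=set0).
  apply: ge_sup; first by exists s.
  move=> _ [v [v1 ->]]; rewrite -ler_sqr ?nnegrE ?sqrtr_ge0 //.
  by rewrite vnorm_sqr (le_trans (h v)) // -vnorm_sqr v1 expr1n mulr1.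
by rewrite sup_out // => -[].
Qed.

Lemma opnorm_ge0 m n (X : 'M[C]_(m, n)) : 0 <= opnorm X.
Proof.
rewrite /opnorm; set E := [set _ | _]; have [[[s Es] hE]|hE] := pselect (has_sup E).
  by apply: le_trans (ub_le_sup hE Es); have [v [_ ->]] := Es; exact: sqrtr_ge0.
by rewrite sup_out.
Qed.

Lemma opnormP m n (X : 'M[C]_(m, n)) :
  is_psd (((opnorm X ^+ 2)%:C)%:M - adj X *m X).
Proof.
apply/psd_gram_bound => v.
have [v0|v0] := eqVneq (sqn v) 0.
  by rewrite v0 mulr0 (sqn_eq0 v0) mulmx0 /sqn adj0 mul0mx mxE.
have vgt : 0 < sqn v by rewrite lt_neqAle eq_sym v0 sqn_ge0.
(* The trace of [adj X *m X] bounds the set of values, so that [sup] really is an upper bound. *)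
have [t ht] : exists t, forall v, sqn (X *m v) <= t * sqn v.
  have [W [x [uW XE x0]]] := psd_spectral (psd_gram X).
  exists (\sum_i x i); apply/psd_gram_bound.
  rewrite XE -(udiag_scalar _ uW) udiagB; apply: psd_udiag => i.
  by rewrite subr_ge0 (bigD1 i) //= lerDl sumr_ge0.
pose c := (vnorm v)^-1; pose u := c%:C *: v.
have vn0 : vnorm v != 0 by rewrite -sqrf_eq0 vnorm_sqr.
have su : sqn u = 1 by rewrite sqnZ /c exprVn vnorm_sqr mulVf.
have nu : vnorm u = 1 by rewrite /vnorm -/(sqn u) su sqrtr1.
have : vnorm (X *m u) <= opnorm X.
  apply: ub_le_sup; last by exists u.
  exists (Num.sqrt t) => _ [w [w1 ->]].
  rewrite /vnorm ler_wsqrtr // (le_trans (ht w)) // -vnorm_sqr w1 expr1n mulr1 //.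
rewrite -ler_sqr ?nnegrE ?sqrtr_ge0 ?opnorm_ge0 // vnorm_sqr /u -scalemxAr sqnZ.
by rewrite /c exprVn vnorm_sqr mulrC ler_pdivrMr.
Qed.

End Norms.

(** * Product states *)

Section ProductStates.
Local Open Scope complex_scope.
Context {R : realType}.
Local Notation C := R[i].
Implicit Types (m n p q : nat) (r : R).

(** With [y = sqrt x] the left side is [4 (y ln (1/y))^2], and [ln z <= z] gives
    [y ln (1/y) <= 1]. *)
Lemma xlnx2_le (x : R) : 0 <= x <= 1 -> x * ln x ^+ 2 <= 4.
Proof.
case/andP; rewrite le0r => /orP[/eqP->|x0] x1; first by rewrite mul0r.
pose y : R := Num.sqrt x; have y0 : 0 < y by rewrite sqrtr_gt0.
have xE : x = y * y by rewrite -expr2 sqr_sqrtr // ltW.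
have lnE : ln x = - 2 * ln (y^-1) by rewrite lnV ?posrE // xE lnM ?posrE //; ring.
have h1 : ln (y^-1) <= y^-1 by rewrite ltW // ln_sublinear // invr_gt0.
have h0 : 0 <= ln (y^-1).
  rewrite ln_ge0 // invf_ge1 // -(@sqrtr1 R) ler_wsqrtr //.
have h : y * ln (y^-1) <= 1 by rewrite -(mulfV (lt0r_neq0 y0)) ler_pM2l.
rewrite lnE [X in X * _]xE (_ : y * y * _ = 4 * (y * ln (y^-1)) ^+ 2); last by ring.
by rewrite ler_piMr // expr_le1 // mulr_ge0 // ltW.
Qed.

Definition is_distr n (x : 'I_n -> R) := (forall i, 0 <= x i) /\ \sum_i x i = 1.

(** The variance of the surprisal [- ln x] under the distribution [x]; its mean is the entropy. *)
Definition lnvar n (x : 'I_n -> R) : R :=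
  \sum_i x i * ln (x i) ^+ 2 - (\sum_i x i * ln (x i)) ^+ 2.

Lemma distr_le1 n (x : 'I_n -> R) i : is_distr x -> x i <= 1.
Proof. by case=> x0 <-; rewrite (bigD1 i) //= lerDl sumr_ge0. Qed.

(** The constant is crude; what matters is that it depends on the dimension alone, since the factors
    of the product state vary with the site. *)
Lemma lnvar_le n (x : 'I_n -> R) : is_distr x -> lnvar x <= n%:R * 4.
Proof.
move=> dx; apply: (@le_trans _ _ (\sum_i x i * ln (x i) ^+ 2)).
  by rewrite gerBl sqr_ge0.
have -> : n%:R * 4 = \sum_(i < n) (4 : R) by rewrite sumr_const card_ord mulr_natl.
by apply: ler_sum => i _; rewrite xlnx2_le // distr_le1 ?andbT //; case: dx.
Qed.

Definition tens_distr m n (x : 'I_m -> R) (y : 'I_n -> R) (k : 'I_(m * n)) :=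
  x (mxtens_unindex k).1 * y (mxtens_unindex k).2.

Lemma is_distr_tens m n (x : 'I_m -> R) (y : 'I_n -> R) :
  is_distr x -> is_distr y -> is_distr (tens_distr x y).
Proof.
move=> [x0 x1] [y0 y1]; split; first by move=> k; exact: mulr_ge0.
by rewrite -mulr_sum x1 y1 mulr1.
Qed.

(** Surprisals of independent factors add, hence so do their variances. The law
    [ln (a * b) = ln a + ln b] needs positive arguments; at 0 the prefactor kills both sides. *)
Lemma lnvar_tens m n (x : 'I_m -> R) (y : 'I_n -> R) :
  is_distr x -> is_distr y -> lnvar (tens_distr x y) = lnvar x + lnvar y.
Proof.
move=> [x0 x1] [y0 y1].
have lnE (a b : R) : 0 <= a -> 0 <= b -> a * b * ln (a * b) = a * ln a * b + a * (b * ln b).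
  rewrite le0r => /orP[/eqP->|a0]; first by rewrite !mul0r addr0.
  rewrite le0r => /orP[/eqP->|b0]; first by rewrite mulr0 !mul0r !mulr0 addr0.
  by rewrite lnM ?posrE //; ring.
have ln2E (a b : R) : 0 <= a -> 0 <= b -> a * b * ln (a * b) ^+ 2 =
    a * ln a ^+ 2 * b + 2 * ((a * ln a) * (b * ln b)) + a * (b * ln b ^+ 2).
  rewrite le0r => /orP[/eqP->|a0]; first by move=> _; rewrite !mul0r; ring.
  rewrite le0r => /orP[/eqP->|b0]; first by rewrite !(mulr0, mul0r); ring.
  by rewrite lnM ?posrE //; ring.
rewrite /lnvar /tens_distr.
under eq_bigr do rewrite ln2E //.
under [X in _ - X ^+ 2]eq_bigr do rewrite lnE //.
rewrite !big_split /= -!mulr_sumr.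
rewrite -(mulr_sum (fun i => x i * ln (x i) ^+ 2) y).
rewrite -(mulr_sum (fun i => x i * ln (x i)) (fun j => y j * ln (y j))).
rewrite -(mulr_sum x (fun j => y j * ln (y j) ^+ 2)).
rewrite -(mulr_sum (fun i => x i * ln (x i)) y).
rewrite -(mulr_sum x (fun j => y j * ln (y j))) x1 y1; ring.
Qed.

Lemma state_spectral n (X : 'M[C]_n) : is_state X ->
  exists W (x : 'I_n -> R), [/\ is_unitary W, X = udiag W x & is_distr x].
Proof.
move=> [/psd_spectral[W [x [uW XE x0]]] trX]; exists W, x; split=> //; split=> //.
by move: trX; rewrite XE mxtrace_udiag // => /complexI.
Qed.

Lemma state_udiag n (W : 'M[C]_n) x : is_unitary W -> is_distr x ->
  is_state (udiag W x).
Proof.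
move=> uW [x0 x1]; split; first exact: psd_udiag.
by rewrite mxtrace_udiag // x1.
Qed.

Lemma state_tens m n (X : 'M[C]_m) (Y : 'M[C]_n) :
  is_state X -> is_state Y -> is_state (X *t Y).
Proof.
move=> [hX tX] [hY tY]; split; first exact: psd_tens.
by rewrite mxtrace_tens tX tY mulr1.
Qed.

(** The variance bound travels with the tensor eigenbasis. Its linear growth makes a typical window
    of width proportional to the number of factors capture almost all the mass. *)
Lemma prodst_rec_spectral d (rho : nat -> 'M[C]_d) k :
  (forall i, is_state (rho i)) ->
  exists W (x : 'I_(d ^ k.+1) -> R), [/\ is_unitary W, prodst_rec rho k = udiag W x,
    is_distr x & lnvar x <= k.+1%:R * (d%:R * 4)].
Proof.
elim: k rho => [|k IH] rho hrho.
  have [W [x [uW rE dx]]] := state_spectral (hrho 0%N).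
  by exists W, x; split=> //; rewrite mul1r; exact: lnvar_le.
have [W [x [uW rE dx]]] := state_spectral (hrho 0%N).
have [V [y [uV sE dy vy]]] := IH (fun i => rho i.+1) (fun i => hrho i.+1).
exists (W *t V), (tens_distr x y); split.
- exact: unitary_tens.
- by rewrite [LHS]/= rE sE udiag_tens.
- exact: is_distr_tens.
- rewrite lnvar_tens // -natr1 mulrDl mul1r addrC.
  by apply: lerD => //; exact: lnvar_le.
Qed.

Lemma state_prodst_rec d (rho : nat -> 'M[C]_d) k :
  (forall i, is_state (rho i)) -> is_state (prodst_rec rho k).
Proof.
by move=> /(prodst_rec_spectral k)[W [x [uW -> dx _]]]; exact: state_udiag.
Qed.

Lemma typical_set n (x : 'I_n -> R) (v t : R) : is_distr x -> lnvar x <= v -> 0 < t ->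
  let H := - \sum_i x i * ln (x i) in
  exists T : {set 'I_n}, [/\
    forall i, i \in T -> x i <= expR (- H + t),
    #|T|%:R <= expR (H + t) &
    \sum_(i | i \notin T) x i <= v / t ^+ 2].
Proof.
move=> dx vx t0 H; have [x0 x1] := dx.
(* Positivity is demanded separately: at a zero eigenvalue [ln] has a default value, which could
   fall into the window. *)
pose T := finset (fun i => (0 < x i) && (`|ln (x i) + H| <= t)); exists T.
have hT i : i \in T -> expR (- (H + t)) <= x i <= expR (- H + t).
  rewrite inE => /andP[xi0]; rewrite ler_norml => /andP[h1 h2].
  by rewrite -{1 2}(lnK (x := x i)) ?posrE // !ler_expR; apply/andP; split; lra.
split; first by move=> i /hT /andP[].
  (* Each index of [T] carries mass at least [exp (- (H + t))] and the total mass is 1. *)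
  rewrite -(ler_pM2r (expR_gt0 (- (H + t)))) -expRD subrr expR0.
  rewrite -[leRHS]x1 mulr_natl -sumr_const [leRHS](bigID (mem T)) /=.
  rewrite -[leLHS]addr0 lerD ?sumr_ge0 //.
  by apply: ler_sum => i /hT /andP[].
rewrite ler_pdivlMr ?exprn_gt0 // mulr_suml.
have vE : lnvar x = \sum_i x i * (ln (x i) + H) ^+ 2.
  transitivity (\sum_i (x i * ln (x i) ^+ 2 + (2 * H) * (x i * ln (x i)) + H ^+ 2 * x i)).
    by rewrite !big_split /= -!mulr_sumr x1 /lnvar /H; ring.
  by apply: eq_bigr => i _; ring.
apply: le_trans vx; rewrite vE [leRHS](bigID (mem T)) /= -[leLHS]add0r.
apply: lerD; first by apply: sumr_ge0 => i _; rewrite mulr_ge0 // sqr_ge0.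
apply: ler_sum => i; rewrite inE negb_and -leNgt => /orP[xi|].
  by rewrite (@le_anti _ _ (x i) 0) ?xi ?x0 // !mul0r.
rewrite -ltNge => h; rewrite ler_wpM2l // -(real_normK (num_real (ln (x i) + H))).
by rewrite ler_sqr ?nnegrE ?(ltW t0) // ltW.
Qed.

Lemma order_bound_tensl m n r (T : 'M[C]_m) : order_bound r T ->
  order_bound r (T *t (1%:M : 'M[C]_n)).
Proof.
move=> [h1 h2]; split.
  by rewrite -(tensmx_scalar1 m n) -tensmxBl; apply: psd_tens => //; exact: psd1.
by rewrite -(tensmx_scalar1 m n) -tensmxDl; apply: psd_tens => //; exact: psd1.
Qed.

Lemma tensmx_1scalar m n (z : C) : (1%:M : 'M[C]_m) *t (z%:M : 'M[C]_n) = z%:M.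
Proof.
rewrite -(tensmx_scalar1 m n).
by apply/matrixP => i j; rewrite !mxE; case: eqP; case: eqP;
  rewrite ?(mulr0n, mulr1n, mul0r, mulr0, mulr1, mul1r).
Qed.

Lemma order_bound_tensr m n r (T : 'M[C]_n) : order_bound r T ->
  order_bound r ((1%:M : 'M[C]_m) *t T).
Proof.
move=> [h1 h2]; split.
  rewrite -(tensmx_1scalar m n) -tensmxNr -tensmxDr.
  by apply: psd_tens => //; exact: psd1.
by rewrite -(tensmx_1scalar m n) -tensmxDr; apply: psd_tens => //; exact: psd1.
Qed.

Lemma order_boundD n r s (T S : 'M[C]_n) : order_bound r T -> order_bound s S ->
  order_bound (r + s) (T + S).
Proof.
move=> [h1 h2] [h3 h4].
have E : ((r + s)%:C)%:M = (r%:C)%:M + (s%:C)%:M :> 'M[C]_n.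
  by apply/matrixP => i j; rewrite !mxE rmorphD mulrnDl.
split; rewrite E.
  by rewrite opprD addrACA; exact: psdD h1 h3.
by rewrite addrACA; exact: psdD h2 h4.
Qed.

Lemma herm_opnorm_sqr n (A : 'M[C]_n) : is_hermitian A ->
  is_psd (((opnorm A ^+ 2)%:C)%:M - A *m A).
Proof. by move=> hA; rewrite -{2}hA; exact: opnormP. Qed.

Lemma herm_opnorm_bound n (A : 'M[C]_n) : is_hermitian A -> order_bound (opnorm A) A.
Proof.
by move=> hA; apply: herm_bound_sqr => //; [exact: opnorm_ge0|exact: herm_opnorm_sqr].
Qed.

Lemma herm_tens m n (X : 'M[C]_m) (Y : 'M[C]_n) :
  is_hermitian X -> is_hermitian Y -> is_hermitian (X *t Y).
Proof. by move=> hX hY; rewrite /is_hermitian adj_tens hX hY. Qed.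

Lemma hermD n (X Y : 'M[C]_n) : is_hermitian X -> is_hermitian Y -> is_hermitian (X + Y).
Proof. by move=> hX hY; rewrite /is_hermitian adjD hX hY. Qed.

Lemma hermB n (X Y : 'M[C]_n) : is_hermitian X -> is_hermitian Y -> is_hermitian (X - Y).
Proof. by move=> hX hY; rewrite /is_hermitian adjB hX hY. Qed.

Lemma herm1 n : is_hermitian (1%:M : 'M[C]_n).
Proof. exact: adjmx1. Qed.

Lemma charge_rec_herm d (A : 'M[C]_d) k : is_hermitian A -> is_hermitian (charge_rec A k).
Proof.
move=> hA; elim: k => [|k IH] //.
by apply: hermD; apply: herm_tens => //; exact: herm1.
Qed.

Lemma charge_rec_bound d (A : 'M[C]_d) k : is_hermitian A ->
  order_bound (k.+1%:R * opnorm A) (charge_rec A k).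
Proof.
move=> hA; elim: k => [|k IH]; first by rewrite mul1r; exact: herm_opnorm_bound.
rewrite -natr1 mulrDl mul1r addrC; apply: order_boundD.
  by apply: order_bound_tensl; exact: herm_opnorm_bound.
exact: order_bound_tensr.
Qed.

Definition qvar n (X A : 'M[C]_n) : R := rtr X (A *m A) - rtr X A ^+ 2.

Lemma qvar_le n (X A : 'M[C]_n) : is_state X -> is_hermitian A ->
  qvar X A <= opnorm A ^+ 2.
Proof.
move=> [pX tX] hA; apply: (@le_trans _ _ (rtr X (A *m A))).
  by rewrite gerBl sqr_ge0.
apply: le_trans (rtr_le pX (herm_opnorm_sqr hA)) _.
by rewrite rtr_scalar tX mulr1.
Qed.

(** Variance plus squared bias. The reference value [a] may differ from the mean: the means of [rho]
    will also serve as reference for [sigma]. *)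
Lemma rtr_centered n (X A : 'M[C]_n) a : is_state X ->
  rtr X ((A - (a%:C)%:M) *m (A - (a%:C)%:M)) = qvar X A + (rtr X A - a) ^+ 2.
Proof.
move=> [_ tX]; rewrite mulmxBr !mulmxBl mul_mx_scalar mul_scalar_mx.
rewrite mul_scalar_mx scale_scalar_mx -rmorphM.
by rewrite !rtrBr !rtrZr rtr_scalar tX /qvar /=; ring.
Qed.

Lemma rtr_tens_state m n (X Y : 'M[C]_m) (Z T : 'M[C]_n) :
  is_state X -> is_hermitian Y -> rtr (X *t Z) (Y *t T) = rtr X Y * rtr Z T.
Proof. by move=> [/psd_herm hX _] hY; exact: rtr_tens. Qed.

Lemma rtr1 n (X : 'M[C]_n) : is_state X -> rtr X 1%:M = 1.
Proof. by move=> [_ tX]; rewrite /rtr mulmx1 tX. Qed.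

Lemma qvar_tens m n (X A : 'M[C]_m) (Y B : 'M[C]_n) :
  is_state X -> is_state Y -> is_hermitian A -> is_hermitian B ->
  qvar (X *t Y) (A *t 1%:M + 1%:M *t B) = qvar X A + qvar Y B.
Proof.
move=> sX sY hA hB; rewrite /qvar mulmxDl !mulmxDr !tensmx_mul !mul1mx !mulmx1 !rtrDr.
have hAA : is_hermitian (A *m A) by rewrite /is_hermitian adjM hA.
rewrite !rtr_tens_state ?rtr1 //; try exact: herm1.
ring.
Qed.

(** The variance is linear in the number of sites while the tolerated squared deviation is
    quadratic, which is what makes Chebyshev's inequality effective. *)
Lemma qvar_prodst d (rho : nat -> 'M[C]_d) A k :
  (forall i, is_state (rho i)) -> is_hermitian A ->
  qvar (prodst_rec rho k) (charge_rec A k) <= k.+1%:R * opnorm A ^+ 2.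
Proof.
move=> + hA; elim: k rho => [|k IH] rho hrho.
  by rewrite mul1r; exact: qvar_le (hrho 0%N) hA.
have := qvar_tens (hrho 0%N) (state_prodst_rec k (fun i => hrho i.+1)) hA
  (charge_rec_herm k hA).
rewrite [prodst_rec rho _]/= [charge_rec A _]/= => ->.
rewrite -natr1 mulrDl mul1r addrC; apply: lerD; last exact: qvar_le.
by apply: IH => i; exact: hrho.
Qed.

End ProductStates.

(** * Transfer of entropy and charges *)

Section Converse.
Local Open Scope complex_scope.
Context {R : realType}.
Local Notation C := R[i].
Implicit Types (m n : nat) (r : R).

Lemma trnorm_ge0 m n (X : 'M[C]_(m, n)) : 0 <= trnorm X.
Proof. by apply: sumr_ge0 => l _; exact: sqrtr_ge0. Qed.

Lemma trnormN n (X : 'M[C]_n) : is_hermitian X -> trnorm (- X) = trnorm X.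
Proof.
move=> /herm_spectral[W [x [uW ->]]].
have -> : - udiag W x = udiag W (fun i => - x i).
  by rewrite /udiag -rdiagN mulmxN mulNmx.
by rewrite !trnorm_udiag //; apply: eq_bigr => i _; rewrite normrN.
Qed.

Lemma herm_conj n (U X : 'M[C]_n) : is_hermitian X -> is_hermitian (U *m X *m adj U).
Proof. by move=> hX; rewrite /is_hermitian !adjM adjK hX mulmxA. Qed.

Lemma psd_conjV m n (U : 'M[C]_(m, n)) (X : 'M[C]_n) : is_psd X -> is_psd (U *m X *m adj U).
Proof. by move=> /(psd_conj (adj U)); rewrite adjK. Qed.

Lemma state_herm n (X : 'M[C]_n) : is_state X -> is_hermitian X.
Proof. by case=> /psd_herm. Qed.

Lemma state_dim n (X : 'M[C]_n) : is_state X -> (0 < n)%N.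
Proof.
by case: n X => // X [_ /eqP]; rewrite /mxtrace big_ord0 eq_sym oner_eq0.
Qed.

Lemma psd_state_compl n (X : 'M[C]_n) : is_state X -> is_psd (1%:M - X).
Proof.
move=> /state_spectral[W [x [uW -> dx]]].
rewrite -(udiag_scalar 1 uW) udiagB; apply: psd_udiag => i.
by rewrite subr_ge0; exact: distr_le1.
Qed.

Lemma tensmxZl m n p q (z : C) (X : 'M[C]_(m, n)) (Y : 'M[C]_(p, q)) :
  (z *: X) *t Y = z *: (X *t Y).
Proof. by apply/matrixP => i j; rewrite !mxE mulrA. Qed.

Definition indic n (T : {set 'I_n}) (i : 'I_n) : R := (i \in T)%:R.

Lemma sum_indic n (T : {set 'I_n}) (x : 'I_n -> R) :
  \sum_i x i * indic T i = \sum_(i in T) x i.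
Proof.
rewrite [RHS]big_mkcond /=; apply: eq_bigr => i _.
by rewrite /indic; case: (i \in T); rewrite ?mulr1 ?mulr0.
Qed.

(** The typical subspace of [rho], rotated by [U], captures almost all of [sigma *t omega]; its
    dimension is too small for that unless the entropy of [sigma] is essentially below that of [rho]. *)
Lemma entropy_transfer D K (rho sigma : 'M[C]_D) (omega' omega : 'M[C]_K)
  (U : 'M[C]_(D * K)) W x V y (v t : R) :
  is_unitary U -> is_state omega' -> is_state omega ->
  is_unitary W -> rho = udiag W x -> is_distr x -> lnvar x <= v ->
  is_unitary V -> sigma = udiag V y -> is_distr y -> lnvar y <= v ->
  0 < t -> v / t ^+ 2 <= 8^-1 ->
  trnorm (U *m (rho *t omega') *m adj U - sigma *t omega) <= 8^-1 ->
  entropy sigma <= entropy rho + 2 * t + ln K%:R + 1.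
Proof.
move=> uU so' so uW rE dx vx uV sE dy vy t0 vt tn.
rewrite rE sE !entropy_udiag //.
have [T [_ cT mT]] := typical_set dx vx t0.
have [T' [bT' _ mT']] := typical_set dy vy t0.
move: cT bT'; set a := - \sum_i x i * _; set b := - \sum_i y i * _ => cT bT'.
pose P := udiag W (indic T); pose Q := U *m (P *t (1%:M : 'M[C]_K)) *m adj U.
have [U1 U2] := uU.
have hP : is_hermitian P by exact: adj_udiag.
have psdP : is_psd P by apply: psd_udiag => i; exact: ler0n.
have psdQ : is_psd Q.
  exact: psd_conjV (psd_tens psdP (@psd1 R K)).
have psdQ' : is_psd (1%:M - Q).
  have -> : 1%:M - Q = U *m ((1%:M - P) *t (1%:M : 'M[C]_K)) *m adj U.
    by rewrite tensmxBl tensmx11 mulmxBr mulmxBl mulmx1 U2.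
  apply: (psd_conjV U (psd_tens _ (@psd1 R K))).
  rewrite -(udiag_scalar 1 uW) udiagB; apply: psd_udiag => i.
  by rewrite /indic; case: (i \in T); rewrite ?subrr ?subr0.
have bQ : order_bound 1 Q := conj psdQ' (psdD (@psd1 R _) psdQ).
have s_rho : is_state rho by rewrite rE; exact: state_udiag.
have s_sigma : is_state sigma by rewrite sE; exact: state_udiag.
have hD : is_hermitian (U *m (rho *t omega') *m adj U - sigma *t omega).
  apply: hermB; last by apply: state_herm; exact: state_tens.
  by apply: herm_conj; apply: state_herm; exact: state_tens.
have e1 : 1 - 8^-1 <= rtr (U *m (rho *t omega') *m adj U) Q.
  rewrite rtr_conj /Q !mulmxA U1 mul1mx -mulmxA U1 mulmx1 rtr_tens_state // rtr1 // mulr1.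
  rewrite rE /rtr udiagM // mxtrace_udiag //= sum_indic.
  rewrite lerBlDr -[leLHS](proj2 dx) (bigID (mem T)) /= lerD2l.
  exact: le_trans mT vt.
have e2 : rtr (U *m (rho *t omega') *m adj U) Q - rtr (sigma *t omega) Q <= 8^-1.
  rewrite -rtrBl; apply: le_trans (ler_norm _) _; apply: le_trans tn.
  by rewrite -[leRHS]mul1r; exact: trnorm_dual.
pose c := expR (- b + t).
(* Here [sigma <= c + tau]: typical eigenvalues are at most [c], and [tau] collects the others, of
   mass at most [8^-1]. *)
have e3 : rtr (sigma *t omega) Q <= c * (#|T|%:R * K%:R) + 8^-1.
  pose tau := udiag V (fun i => y i * (i \notin T')%:R).
  have htau : is_psd tau by apply: psd_udiag => i; rewrite mulr_ge0 // (proj1 dy).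
  have ptau : is_psd ((c%:C)%:M + tau - sigma).
    rewrite -(udiag_scalar c uV) sE udiagD udiagB; apply: psd_udiag => i.
    case: (boolP (i \in T')) => iT; rewrite ?mulr1 ?mulr0 ?addr0 ?subr_ge0.
      exact: bT'.
    by rewrite lerDr expR_ge0.
  have h1 : rtr (sigma *t omega) Q <= rtr (((c%:C)%:M + tau) *t omega) Q.
    rewrite -subr_ge0 -rtrBl -tensmxBl; apply: (rtr_ge0 _ psdQ).
    exact: psd_tens ptau (proj1 so).
  have h2 : rtr (tau *t omega) Q <= 8^-1.
    have pto : is_psd (tau *t omega) := psd_tens htau (proj1 so).
    apply: le_trans (rtr_le pto psdQ') _.
    rewrite /rtr mulmx1 mxtrace_tens (proj2 so) mulr1 mxtrace_udiag //=.
    apply: le_trans vt; apply: le_trans mT'; rewrite [leRHS]big_mkcond /=.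
    by apply: ler_sum => i _; case: (i \in T'); rewrite ?mulr1 ?mulr0.
  (* Since [omega <= 1], the left side is at most the trace of [Q], which is that of [P *t 1]. *)
  have h3 : rtr ((1%:M : 'M[C]_D) *t omega) Q <= #|T|%:R * K%:R.
    apply: (@le_trans _ _ (rtr 1%:M Q)).
      rewrite -(tensmx11 D K) -subr_ge0 -rtrBl -tensmxNr -tensmxDr.
      exact: rtr_ge0 (psd_tens (@psd1 R D) (psd_state_compl so)) psdQ.
    rewrite rtrC rtr_conj mulmx1 U1 -(tensmx11 D K) rtr_tens //; last exact: herm1.
    rewrite /rtr !mulmx1 mxtrace_udiag // mxtrace1.
    have -> : complex.Re (K%:R : C) = K%:R by rewrite -(rmorph_nat (real_complex R)).
    rewrite /= ler_wpM2r // -(eq_bigr _ (fun i _ => mul1r (indic T i))) sum_indic.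
    by rewrite sumr_const.
  apply: le_trans h1 _; rewrite tensmxDl rtrDl; apply: lerD => //.
  by rewrite -scalemx1 tensmxZl rtrZl ler_wpM2l ?expR_ge0.
have K0 : (0 < K)%N := state_dim so.
rewrite leNgt; apply/negP => hlt.
(* The additive 1 in the conclusion leaves an exponent below [-1]. With this bound [e1], [e2] and
   [e3] would give [7/8 - 1/8 <= 1/2 + 1/8], a contradiction. *)
have h4 : c * (#|T|%:R * K%:R) <= 2^-1.
  apply: (@le_trans _ _ (expR (- 1))); last first.
    rewrite expRN lef_pV2 ?posrE ?expR_gt0 //.
    by apply: le_trans (expR_ge1Dx 1); rewrite -natr1.
  have KR : (0 : R) < K%:R by rewrite ltr0n.
  rewrite -[K%:R](lnK KR) /c.
  apply: (@le_trans _ _ (expR (- b + t) * (expR (a + t) * expR (ln K%:R)))).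
    by rewrite ler_wpM2l ?expR_ge0 // ler_wpM2r ?expR_ge0.
  by rewrite -!expRD ler_expR; lra.
move: (rtr _ _) (rtr _ _) (_ * (_ * _)) e1 e2 e3 h4; clear => p q s; lra.
Qed.

Lemma cabs_real r : cabs (r%:C : C) = `|r|.
Proof. by rewrite /cabs normc_def /= expr0n /= addr0 sqrtr_sqr. Qed.

(** Moving [U] from the state to the observable splits the difference into the error on states,
    weighted by the size of [A], and the expectation of [T - adj U *m T *m U], whose norm is
    governed by the commutator. *)
Lemma charge_transfer D K (rho sigma A : 'M[C]_D) (omega' omega : 'M[C]_K)
  (U : 'M[C]_(D * K)) a :
  is_unitary U -> is_state rho -> is_state sigma -> is_state omega' -> is_state omega ->
  is_hermitian A -> order_bound a A ->
  cabs (\tr (rho *m A) - \tr (sigma *m A)) <=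
    a * trnorm (U *m (rho *t omega') *m adj U - sigma *t omega) +
    opnorm (U *m (A *t 1%:M) - (A *t 1%:M) *m U).
Proof.
move=> uU sr ss so' so hA bA; set T := A *t 1%:M; have [U1 U2] := uU.
rewrite !herm_rtr //; try exact: state_herm.
rewrite -rmorphB cabs_real.
have hT : is_hermitian T := herm_tens hA (@herm1 R K).
have bT : order_bound a T := order_bound_tensl K bA.
have e (X : 'M[C]_D) (Y : 'M[C]_K) : is_state X -> is_state Y -> rtr X A = rtr (X *t Y) T.
  by move=> sX sY; rewrite rtr_tens_state // rtr1 // mulr1.
rewrite (e _ _ sr so') (e _ _ ss so).
set X := rho *t omega'; set Y := sigma *t omega.
have sX : is_state X := state_tens sr so'.
have sY : is_state Y := state_tens ss so.
pose Z := T - adj U *m T *m U.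
have -> : rtr X T - rtr Y T = rtr (U *m X *m adj U - Y) T + rtr X Z.
  by rewrite rtrBl rtr_conj /Z rtrBr; ring.
apply: le_trans (ler_normD _ _) _; apply: lerD.
  apply: trnorm_dual => //; apply: hermB; last exact: state_herm.
  exact: herm_conj (state_herm sX).
have hZ : is_hermitian Z.
  by apply: hermB => //; have := herm_conj (adj U) hT; rewrite adjK.
have ZE : Z = adj U *m (U *m T - T *m U).
  by rewrite mulmxBr !mulmxA U1 mul1mx.
have bZ : order_bound (opnorm (U *m T - T *m U)) Z.
  apply: herm_bound_sqr => //; first exact: opnorm_ge0.
  rewrite -{1}hZ {}ZE adjM adjK mulmxA -(mulmxA _ U) U2 mulmx1.
  exact: opnormP.
apply: le_trans (trnorm_dual (state_herm sX) bZ) _.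
by rewrite (trnorm_psd (proj1 sX)) (proj2 sX) mulr1.
Qed.

End Converse.

(** * Embezzling distributions *)

Section Embezzlement.
Local Open Scope complex_scope.
Context {R : realType}.
Implicit Types (m n : nat).

Lemma sort_perm n (f : 'I_n -> R) :
  exists s : {perm 'I_n}, forall i j : 'I_n, (i <= j)%N -> f (s j) <= f (s i).
Proof.
pose leT (i j : 'I_n) := f j <= f i.
have leT_tr : transitive leT by move=> y x z h1 h2; exact: le_trans h2 h1.
have leT_tot : total leT by move=> x y; rewrite /leT le_total.
pose u := sort leT (enum 'I_n).
have szu : size u = n by rewrite size_sort size_enum_ord.
have uu : uniq u by rewrite sort_uniq enum_uniq.
have inj : injective (fun i : 'I_n => nth i u i).
  move=> i j /=; rewrite (set_nth_default j) ?szu // => /eqP.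
  by rewrite nth_uniq ?szu // => /eqP/val_inj.
exists (perm inj) => i j ij; rewrite !permE (set_nth_default i) ?szu //.
apply: (sorted_leq_nth leT_tr _ i (sort_sorted leT_tot (enum 'I_n))) => //.
- by move=> x; exact: lexx.
- by rewrite inE szu.
- by rewrite inE szu.
Qed.

Lemma count_le (x : R) n : 0 <= x -> \sum_(j < n) (j.+1%:R <= x)%R%:R <= x.
Proof.
(* The bound by [n] carries the induction: when [n.+1 <= x], it yields a count of at most [n.+1],
   hence at most [x]. *)
move=> x0; suff : \sum_(j < n) (j.+1%:R <= x)%R%:R <= Num.min n%:R x.
  by rewrite le_min => /andP[].
elim: n => [|n IH]; first by rewrite big_ord0 le_min lexx.
rewrite big_ord_recr /=; move: IH; rewrite !le_min => /andP[h1 h2].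
have hb : (n.+1%:R <= x)%R%:R <= 1 :> R by rewrite lern1 leq_b1.
have h3 := lerD h1 hb; rewrite natr1 in h3; rewrite h3 /=.
case: (boolP (n.+1%:R <= x)) => h; last by rewrite addr0.
apply: le_trans h; have := lerD h1 (lexx (1 : R)); rewrite natr1; exact.
Qed.

Lemma sum_leq_ord n (k : 'I_n) : \sum_(i < n) (i <= k)%:R = k.+1%:R :> R.
Proof.
rewrite -[in RHS](card_ord k.+1) -sumr_const (big_ord_widen n (fun=> 1)) //=.
by rewrite [RHS]big_mkcond /=; apply: eq_bigr => i _; rewrite ltnS; case: leqP.
Qed.

Definition harmonic_sum n : R := \sum_(j < n) j.+1%:R^-1.

Lemma ln_succ_le n : ln (n.+2%:R : R) <= ln n.+1%:R + n.+1%:R^-1.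
Proof.
have n0 : (0 : R) < n.+1%:R by rewrite ltr0n.
have -> : (n.+2%:R : R) = n.+1%:R * (1 + n.+1%:R^-1).
  by rewrite mulrDr mulr1 divff ?gt_eqF // -natr1.
rewrite lnM ?posrE ?addr_gt0 ?invr_gt0 // lerD2l le_ln1Dx //.
by rewrite (lt_trans _ (_ : 0 < _)) ?invr_gt0 // ltrN10.
Qed.

Lemma ln_succ_ge n : ln (n.+1%:R : R) + n.+2%:R^-1 <= ln n.+2%:R.
Proof.
have n0 : (0 : R) < n.+1%:R by rewrite ltr0n.
have n1 : (0 : R) < n.+2%:R by rewrite ltr0n.
have e : 1 + - n.+2%:R^-1 = n.+1%:R / n.+2%:R :> R.
  by apply: (mulIf (lt0r_neq0 n1)); rewrite divfK ?lt0r_neq0 // mulrDl mul1r mulNr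
    mulVf ?lt0r_neq0 // -[n.+2%:R]natr1 addrK.
have h : -1 < - n.+2%:R^-1 :> R by rewrite ltrN2 invf_lt1 // ltr1n.
have := le_ln1Dx h; rewrite e ln_div ?posrE //.
by move: (ln n.+1%:R) (ln n.+2%:R) (n.+2%:R^-1) => a b c; lra.
Qed.

Lemma ln_le_harmonic n : ln (n.+1%:R : R) <= harmonic_sum n.
Proof.
elim: n => [|n IH]; first by rewrite ln1 /harmonic_sum big_ord0.
by rewrite /harmonic_sum big_ord_recr /=; apply: le_trans (ln_succ_le n) _; rewrite lerD2r.
Qed.

Lemma harmonic_window (x1 x2 : R) n : 0 < x1 -> x1 <= x2 ->
  \sum_(m < n) (x1 < m.+1%:R <= x2)%R%:R / m.+1%:R <= 1 + ln (x2 / x1).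
Proof.
move=> x10 x12; pose F k := \sum_(m < k) (x1 < m.+1%:R <= x2)%R%:R / m.+1%:R : R.
have x20 : 0 < x2 := lt_le_trans x10 x12.
(* The invariant remembers the last index [j] counted so far. The first term costs at most 1, and
   each later one at most the increment of [ln]. *)
have H : F n = 0 \/ exists j, [/\ (j < n)%N, x1 < j.+1%:R <= x2 & F n <= 1 + ln (j.+1%:R / x1)].
  elim: n => [|n IH]; first by left; rewrite /F big_ord0.
  rewrite /F big_ord_recr -/(F n) /=.
  case: (boolP (x1 < n.+1%:R <= x2)) => h; last first.
    rewrite mul0r addr0; case: IH => [->|[j [h1 h2 h3]]]; first by left.
    by right; exists j; split => //; exact: ltnW.
  right; exists n; split => //; rewrite mul1r.
  have /andP[h1 h2] := h.
  have n0 : (0 : R) < n.+1%:R by rewrite ltr0n.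
  case: IH => [->|[j [jn j1 Fj]]].
    rewrite add0r -[leLHS]addr0 lerD ?invf_le1 ?ler1n // ln_ge0 //.
    by rewrite ler_pdivlMr // mul1r ltW.
  case: n jn h h1 h2 n0 Fj => // n jn h h1 h2 n0 Fj.
  apply: (@le_trans _ _ (1 + ln (n.+1%:R / x1) + n.+2%:R^-1)).
    rewrite lerD2r; apply: le_trans Fj _; rewrite lerD2l ler_ln ?posrE ?divr_gt0 ?ltr0n //.
    by rewrite ler_pM2r ?invr_gt0 // ler_nat.
  rewrite -addrA lerD2l !ln_div ?posrE ?ltr0n // addrAC lerD2r.
  exact: ln_succ_ge.
rewrite -/(F n); case: H => [->|[j [_ /andP[j1 j2] Fj]]].
  by rewrite addr_ge0 // ln_ge0 // ler_pdivlMr // mul1r.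
apply: le_trans Fj _; rewrite lerD2l ler_ln ?posrE ?divr_gt0 ?ltr0n //.
by rewrite ler_pM2r ?invr_gt0.
Qed.

(** A sorted sequence below [1 / (H m)] of total mass about 1 and supported in a window whose
    logarithmic length is about [H] is close to [1 / (H m)] on that window. *)
Lemma sorted_close n (a a' : 'I_n -> R) (H M x2 eta : R) :
  0 < H -> 0 < M -> M^-1 <= x2 ->
  (forall c, c = a \/ c = a' ->
    [/\ forall m : 'I_n, 0 <= c m, forall m : 'I_n, c m <= (H * m.+1%:R)^-1,
        forall m : 'I_n, c m <= M / H, forall m : 'I_n, c m != 0 -> m.+1%:R <= x2 &
        1 - eta <= \sum_m c m]) ->
  \sum_m `|a m - a' m| <= 2 * (3 + ln (M * x2)) / H - 2 * (1 - eta).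
Proof.
move=> H0 M0 Mx2 hc; have x10 : 0 < M^-1 by rewrite invr_gt0.
have [a0 a1 a2 a3 a4] := hc a (or_introl erefl).
have [b0 b1 b2 b3 b4] := hc a' (or_intror erefl).
pose w (m : 'I_n) : R := (M^-1 < m.+1%:R <= x2)%R%:R / m.+1%:R.
pose l (m : 'I_n) : R := (m.+1%:R <= M^-1)%R%:R * M.
(* As [|p - q| = 2 max p q - (p + q)], an envelope for both sequences suffices: [M / H] up to index
   [1 / M] (doubled here, with room to spare), [1 / (H m)] inside the window, 0 beyond it. *)
have pt (m : 'I_n) : `|a m - a' m| <= (2 / H * w m + 4 / H * l m) - (a m + a' m).
  have Hi : 0 < H^-1 by rewrite invr_gt0.
  have m0 : (0 : R) < m.+1%:R by rewrite ltr0n.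
  have := a0 m; have := b0 m; have := a1 m; have := b1 m; have := a2 m; have := b2 m.
  have := a3 m; have := b3 m; rewrite /w /l invfM.
  case: (leP m.+1%:R M^-1) => /= hm.
    rewrite !mul0r mulr0 add0r mul1r => _ _.
    have -> : 4 / H * M = 4 * (M / H) by ring.
    move: (a m) (a' m) (M / H) => p q r h2 h3 _ _ h4 h5.
    by rewrite ler_norml; apply/andP; split; lra.
  case: (leP m.+1%:R x2) => /= hx.
    rewrite mul0r mulr0 addr0 mul1r => _ _.
    have -> : 2 / H * m.+1%:R^-1 = 2 * (H^-1 * m.+1%:R^-1) by ring.
    move: (a m) (a' m) (H^-1 * _) => p q r _ _ h2 h3 h4 h5.
    by rewrite ler_norml; apply/andP; split; lra.
  move=> h3 h4 _ _ _ _ _ _.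
  have -> : a m = 0 by case: (eqVneq (a m) 0) => // /h4.
  have -> : a' m = 0 by case: (eqVneq (a' m) 0) => // /h3.
  by rewrite subrr normr0 !mul0r !mulr0 !addr0 subrr.
apply: (@le_trans _ _ (\sum_m ((2 / H * w m + 4 / H * l m) - (a m + a' m)))).
  by apply: ler_sum => m _; exact: pt.
rewrite sumrB !big_split /= -!mulr_sumr.
have hw : \sum_m w m <= 1 + ln (x2 / M^-1) by exact: harmonic_window.
have hl : \sum_m l m <= 1.
  have := count_le n (ltW x10).
  by rewrite -(ler_pM2r M0) mulVf ?lt0r_neq0 // mulr_suml.
have h1 : 2 / H * \sum_m w m <= 2 / H * (1 + ln (x2 / M^-1)).
  by rewrite ler_wpM2l // divr_ge0 // ltW.
have h2 : 4 / H * \sum_m l m <= 4 / H * 1.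
  by rewrite ler_wpM2l // divr_ge0 // ltW.
have -> : 2 * (3 + ln (M * x2)) / H = 2 / H * (1 + ln (x2 / M^-1)) + 4 / H * 1.
  by rewrite invrK [x2 * M]mulrC; ring.
lra.
Qed.

End Embezzlement.

(** * Matching two embezzled spectra by a permutation respecting a subspace *)

Section Matching.
Local Open Scope complex_scope.
Context {R : realType}.
Implicit Types (m n D N : nat).

Lemma sum_tens m n (F : 'I_m -> 'I_n -> R) :
  \sum_(k < m * n) F (mxtens_unindex k).1 (mxtens_unindex k).2 = \sum_i \sum_j F i j.
Proof.
rewrite pair_big /=; symmetry.
rewrite (reindex (@mxtens_unindex m n)) //=.
by exists (@mxtens_index m n) => k _; rewrite ?mxtens_indexK ?mxtens_unindexK.
Qed.

(** The van Dam--Hayden embezzling distribution. *)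
Definition embez N (j : 'I_N) : R := (harmonic_sum N * j.+1%:R)^-1.

Lemma harmonic_sum_gt0 N : (0 < N)%N -> 0 < harmonic_sum N :> R.
Proof.
case: N => // N _; rewrite /harmonic_sum big_ord_recl ltr_wpDr ?invr_gt0 ?ltr0n //.
by apply: sumr_ge0 => i _; rewrite invr_ge0.
Qed.

Lemma embez_gt0 N (j : 'I_N) : 0 < embez j.
Proof.
by rewrite /embez invr_gt0 mulr_gt0 ?ltr0n // harmonic_sum_gt0 // (leq_ltn_trans _ (ltn_ord j)).
Qed.

Lemma embez_distr N : (0 < N)%N -> is_distr (@embez N).
Proof.
move=> N0; split; first by move=> j; exact/ltW/embez_gt0.
under eq_bigr do rewrite /embez invfM.
by rewrite -mulr_sumr mulVf // lt0r_neq0 // harmonic_sum_gt0.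
Qed.

(** Genuine weights are nonnegative, so the key -1 sorts all indices outside [b] last. Zero weights
    inside [b] are thereby kept apart from those outside. *)
Definition sort_key D N (b : pred 'I_D) (p : 'I_D -> R) (k : 'I_(D * N)) : R :=
  if b (mxtens_unindex k).1 then tens_distr p (@embez N) k else -1.

(** The cap on [a m] is a count: for a value [tau], each [i] admits at most [p i / (H tau)] positive
    integers [j] with [p i / (H j) >= tau], so at most [1 / (H tau)] pairs reach [tau]; when
    [tau = a m], at least [m.+1] of them do. *)
Lemma sorted_profile D N (p : 'I_D -> R) (b : pred 'I_D) (s : {perm 'I_(D * N)}) (M L eta : R) :
  (0 < N)%N -> (forall i, 0 <= p i) -> (forall i, p i <= M) -> (forall i, p i != 0 -> b i) ->
  1 - eta <= \sum_i p i <= 1 -> \sum_i ((p i != 0)%:R : R) <= L ->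
  (forall i j : 'I_(D * N), (i <= j)%N -> sort_key b p (s j) <= sort_key b p (s i)) ->
  let a (m : 'I_(D * N)) := tens_distr p (@embez N) (s m) in
  [/\ forall m : 'I_(D * N), 0 <= a m, forall m : 'I_(D * N), a m <= (harmonic_sum N * m.+1%:R)^-1,
      forall m : 'I_(D * N), a m <= M / harmonic_sum N,
      forall m : 'I_(D * N), a m != 0 -> m.+1%:R <= N%:R * L &
      1 - eta <= \sum_m a m].
Proof.
move=> N0 p0 pM pb /andP[sp1 sp2] pL hs a.
have H0 := harmonic_sum_gt0 N0; set H := harmonic_sum N in H0 *.
have x0 k : 0 <= tens_distr p (@embez N) k by rewrite mulr_ge0 // ltW // embez_gt0.
have a0 (m : 'I_(D * N)) : 0 <= a m by exact: x0.
have az (j : 'I_(D * N)) : ~~ b (mxtens_unindex (s j)).1 -> a j = 0.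
  move=> hj; rewrite /a /tens_distr.
  case: (eqVneq (p (mxtens_unindex (s j)).1) 0) => [->|/pb]; first by rewrite mul0r.
  by rewrite (negbTE hj).
have mono (i j : 'I_(D * N)) : (i <= j)%N -> a j <= a i.
  move=> ij; have := hs i j ij; rewrite /sort_key -!/(a _).
  case: ifPn => hj; case: ifPn => hi // h.
    by have := le_trans (a0 j) h; rewrite ler0N1.
    by rewrite (az j hj); exact: a0.
  by rewrite (az j hj); exact: a0.
have reindex_s (F : 'I_(D * N) -> R) : \sum_m F (s m) = \sum_k F k.
  by rewrite [RHS](reindex_perm s).
split => //.
- move=> m; set tau := a m.
  have := a0 m; rewrite -/tau le0r => /orP[/eqP->|t0].
    by rewrite invr_ge0 mulr_ge0 // ltW.
  have m0 : (0 : R) < m.+1%:R by rewrite ltr0n.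
  suff : m.+1%:R * tau <= H^-1.
    by move=> h; rewrite invfM ler_pdivlMr // mulrC.
  rewrite -(sum_leq_ord m) mulr_suml.
  apply: (@le_trans _ _ (\sum_k (tau <= tens_distr p (@embez N) k)%R%:R * tau)).
    rewrite -(reindex_s (fun k => (tau <= tens_distr p (@embez N) k)%R%:R * tau)).
    apply: ler_sum => i _; rewrite ler_wpM2r ?(ltW t0) // ler_nat.
    by case: (leqP i m) => // /mono h; rewrite /tau (h : tau <= _).
  rewrite (sum_tens (fun i j => (tau <= p i * embez j)%R%:R * tau)).
  apply: (@le_trans _ _ (\sum_i p i / H)); last first.
    by rewrite -mulr_suml ler_piMl // invr_ge0 ltW.
  apply: ler_sum => i _; rewrite -mulr_suml -ler_pdivlMr //.
  have -> : \sum_(j < N) (tau <= p i * embez j)%R%:R =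
            \sum_(j < N) (j.+1%:R <= p i / H / tau)%R%:R :> R.
    apply: eq_bigr => j _; congr (nat_of_bool _)%:R.
    by rewrite [RHS]ler_pdivlMr // /embez invfM mulrA [LHS]ler_pdivlMr ?ltr0n // mulrC.
  have tau0 := ltW t0; have HH := ltW H0.
  by apply: count_le; apply: divr_ge0 => //; apply: divr_ge0.
- move=> m; rewrite /a /tens_distr ler_pM ?(ltW (embez_gt0 _)) //.
  by rewrite /embez invfM ler_piMr ?invr_ge0 ?(ltW H0) // invf_le1 ?ltr0n // ler1n.
- move=> m am; rewrite -(sum_leq_ord m).
  apply: (@le_trans _ _ (\sum_k (tens_distr p (@embez N) k != 0)%:R)).
    rewrite -(reindex_s (fun k => (tens_distr p (@embez N) k != 0)%:R)).
    apply: ler_sum => i _; rewrite ler_nat.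
    case: (leqP i m) => // /mono h; rewrite lt0b; apply/eqP => ai.
    by move: h; rewrite [a i]ai; move: am (a0 m); case: ltgtP.
  rewrite (sum_tens (fun i j => (p i * embez j != 0)%:R)).
  apply: (@le_trans _ _ (\sum_i \sum_(j < N) (p i != 0)%:R)).
    apply: ler_sum => i _; apply: ler_sum => j _; rewrite ler_nat.
    by case: (eqVneq (p i) 0) => [->|_]; rewrite ?leq_b1 // mul0r eqxx.
  have -> : \sum_i \sum_(j < N) (p i != 0)%:R = N%:R * \sum_i (p i != 0)%:R :> R.
    by rewrite mulr_sumr; apply: eq_bigr => i _; rewrite sumr_const card_ord [RHS]mulr_natl.
  by rewrite ler_wpM2l.
- rewrite reindex_s /tens_distr -mulr_sum (proj2 (embez_distr N0)) mulr1 //.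
Qed.

Lemma down_closed_eq n (A B : {set 'I_n}) :
  (forall i j : 'I_n, (i <= j)%N -> j \in A -> i \in A) ->
  (forall i j : 'I_n, (i <= j)%N -> j \in B -> i \in B) ->
  #|A| = #|B| -> A = B.
Proof.
move=> hA hB cAB; case: (boolP (A \subset B)) => [sAB|/fintype.subsetPn[i iA iB]].
  by apply/eqP; rewrite eqEcard sAB cAB leqnn.
apply/esym/eqP; rewrite eqEcard cAB leqnn andbT; apply/fintype.subsetP => j jB.
case: (leqP j i) => [ji|/ltnW ij]; first exact: hA ji iA.
by move: iB; rewrite (hB _ _ ij jB).
Qed.

(** The permutation undoes one sorting and applies the other. In both, the selected indices form
    initial segments, of equal length by the count hypothesis, so [b] goes to [b']. The window has
    logarithmic length [ln N + ln (M * L)] while the harmonic sum is at least [ln N.+1]; only the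
    excess is paid. *)
Lemma embezzle_match D N (p q : 'I_D -> R) (b b' : pred 'I_D) (M L eta : R) :
  (0 < N)%N -> 0 < M -> 1 <= M * L ->
  (forall i, 0 <= p i) -> (forall i, p i <= M) -> (forall i, p i != 0 -> b i) ->
  1 - eta <= \sum_i p i <= 1 -> \sum_i ((p i != 0)%:R : R) <= L ->
  (forall i, 0 <= q i) -> (forall i, q i <= M) -> (forall i, q i != 0 -> b' i) ->
  1 - eta <= \sum_i q i <= 1 -> \sum_i ((q i != 0)%:R : R) <= L ->
  \sum_i (b i : nat) = \sum_i (b' i : nat) ->
  exists s : {perm 'I_(D * N)},
    (forall k, b' (mxtens_unindex (s k)).1 = b (mxtens_unindex k).1) /\
    \sum_k `|tens_distr p (@embez N) k - tens_distr q (@embez N) (s k)| <=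
      2 * (3 + ln (M * L)) / ln N.+1%:R + 2 * eta.
Proof.
move=> N0 M0 ML p0 pM pb sp pL q0 qM qb sq qL cb.
have [s hs] := sort_perm (sort_key (N := N) b p).
have [t ht] := sort_perm (sort_key (N := N) b' q).
have hp := sorted_profile N0 p0 pM pb sp pL hs.
have hq := sorted_profile N0 q0 qM qb sq qL ht.
have down (c : pred 'I_D) (x : 'I_D -> R) (u : {perm 'I_(D * N)}) : (forall i, 0 <= x i) ->
    (forall i j : 'I_(D * N), (i <= j)%N -> sort_key c x (u j) <= sort_key c x (u i)) ->
    forall i j : 'I_(D * N), (i <= j)%N ->
      j \in finset (fun m : 'I_(D * N) => c (mxtens_unindex (u m)).1) ->
      i \in finset (fun m : 'I_(D * N) => c (mxtens_unindex (u m)).1).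
  move=> x0 hu i j ij; rewrite !inE => cj; have := hu i j ij; rewrite /sort_key cj.
  case: ifP => // _ h; have : 0 <= tens_distr x (@embez N) (u j).
    by rewrite mulr_ge0 // ltW // embez_gt0.
  by move=> /le_trans /(_ h); rewrite ler0N1.
have card_c (c : pred 'I_D) (u : {perm 'I_(D * N)}) :
    #|finset (fun m : 'I_(D * N) => c (mxtens_unindex (u m)).1)| = (\sum_i (c i : nat) * N)%N.
  rewrite -sum1_card big_mkcond /=.
  under eq_bigr do rewrite inE.
  transitivity (\sum_(k < D * N) (c (mxtens_unindex k).1 : nat))%N.
    by rewrite [RHS](reindex_perm u); apply: eq_bigr => k _; case: (c _).
  rewrite (reindex (@mxtens_index D N)); last first.
    by exists (@mxtens_unindex D N) => k _; rewrite ?mxtens_indexK ?mxtens_unindexK.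
  under eq_bigr do rewrite mxtens_indexK.
  rewrite -(pair_big predT predT (fun i (j : 'I_N) => (c i : nat))) /=.
  by apply: eq_bigr => i _; rewrite sum_nat_const card_ord mulnC.
have eqS : finset (fun m : 'I_(D * N) => b (mxtens_unindex (s m)).1) =
           finset (fun m : 'I_(D * N) => b' (mxtens_unindex (t m)).1).
  apply: down_closed_eq; [exact: down p0 hs|exact: down q0 ht|].
  by rewrite !card_c -!big_distrl /= cb.
exists (s^-1 * t)%g; split.
  move=> k; have := congr1 (fun S : {set _} => s^-1%g k \in S) eqS.
  by rewrite !inE permKV permM => ->.
have H0 := harmonic_sum_gt0 N0.
have N0R : (0 : R) < N%:R by rewrite ltr0n.
rewrite (reindex_perm s) /=; under eq_bigr do rewrite permM permK.
have MN : M^-1 <= N%:R * L.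
  rewrite -(ler_pM2l M0) divff ?lt0r_neq0 //; apply: (le_trans ML).
  rewrite mulrCA ler_peMl ?ler1n //; exact: le_trans ler01 ML.
have := @sorted_close _ _ (fun m : 'I_(D * N) => tens_distr p (@embez N) (s m))
  (fun m : 'I_(D * N) => tens_distr q (@embez N) (t m)) _ M _ eta H0 M0 MN.
move=> /(_ _)/le_trans; apply; first by move=> c [->|->].
have L1 : 0 < ln N.+1%:R :> R by rewrite ln_gt0 // ltr1n.
have L2 := @ln_le_harmonic R N.
have L3 : ln (N%:R : R) <= ln N.+1%:R by rewrite ler_ln ?posrE ?ltr0n // ler_nat.
have ML0 : 0 < M * L := lt_le_trans ltr01 ML.
have -> : ln (M * (N%:R * L)) = ln N%:R + ln (M * L).
  rewrite mulrCA [in LHS]lnM ?posrE //.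
have lnML : 0 <= ln (M * L) by exact: ln_ge0.
apply: (@le_trans _ _ (2 * (3 + ln (M * L)) / harmonic_sum N + 2 * eta)).
  have h : ln N%:R / harmonic_sum N <= 1 :> R.
    by rewrite ler_pdivrMr // mul1r (le_trans L3).
  move: h; move: (harmonic_sum N)^-1 (ln N%:R) (ln (M * L)) => u v w h.
  have -> : 2 * (3 + (v + w)) * u - 2 * (1 - eta) =
            (2 * (3 + w) * u + 2 * eta) + 2 * (v * u - 1) by ring.
  by rewrite gerDl pmulr_rle0 // subr_le0.
rewrite lerD2r; apply: ler_wpM2l; first by rewrite mulr_ge0 // addr_ge0.
by rewrite lef_pV2 ?posrE.
Qed.

End Matching.

(** * Truncation of states *)

Section Truncation.
Local Open Scope complex_scope.
Context {R : realType}.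
Local Notation C := R[i].
Implicit Types (m n D N : nat) (r : R).

Definition is_proj n (P : 'M[C]_n) := is_hermitian P /\ P *m P = P.

Lemma proj_compl n (P : 'M[C]_n) : is_proj P -> is_proj (1%:M - P).
Proof.
move=> [hP PP]; split; first exact: hermB (@herm1 R n) hP.
by rewrite mulmxBl mul1mx mulmxBr mulmx1 PP subrr subr0.
Qed.

Lemma psd_proj n (P : 'M[C]_n) : is_proj P -> is_psd P.
Proof. by move=> [hP <-]; exact: psd_sqr. Qed.

Lemma psd_compress n (P X Y : 'M[C]_n) : is_hermitian P ->
  is_psd (Y - X) -> is_psd (P *m Y *m P - P *m X *m P).
Proof.
by move=> hP /(psd_conjV P); rewrite hP mulmxBr mulmxBl.
Qed.

(** Expanding [0 <= (s G - Q)^2] with [Q = 1 - P] and [s = sqrt h]. *)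
Lemma gentle_measurement n (X P : 'M[C]_n) (h : R) : is_psd X -> complex.Re (\tr X) <= 1 ->
  is_proj P -> 0 < h -> rtr X (1%:M - P) <= h ->
  trnorm (X - P *m X *m P) <= 2 * Num.sqrt h + h.
Proof.
move=> pX tX pP h0 hX; have pQ := proj_compl pP; have [hP PP] := pP.
set Q := 1%:M - P in hX pQ; have [hQ QQ] := pQ.
have hXP : is_hermitian (X - P *m X *m P).
  by apply: hermB; [exact: psd_herm|rewrite -{2}hP; apply: herm_conj; exact: psd_herm].
have [G [hG GG <-]] := trnorm_attained hXP.
(* This is [G - P G P = Q G + G Q - Q G Q]; the linear terms will cost [2 sqrt h], the last one
   [h]. *)
have -> : rtr (X - P *m X *m P) G = rtr X (Q *m G + G *m Q) - rtr X (Q *m G *m Q).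
  have -> : rtr (X - P *m X *m P) G = rtr X (G - P *m G *m P).
    by rewrite rtrBl rtrBr -{2}hP rtr_conj hP.
  rewrite -rtrBr; congr rtr; rewrite /Q.
  rewrite !(mulmxBl, mulmxBr, mul1mx, mulmx1).
  move: (P *m G) (G *m P) (P *m G *m P) => a b c.
  by apply/matrixP => i j; rewrite !mxE; ring.
clearbody Q; set s := Num.sqrt h; have s0 : 0 < s by rewrite sqrtr_gt0.
have ss : s ^+ 2 = h by rewrite sqr_sqrtr // ltW.
have h1 : rtr X (Q *m G + G *m Q) <= 2 * s.
  have hK : is_hermitian (s%:C *: G - Q) by rewrite /is_hermitian adjB adjZ hG hQ.
  have := rtr_ge0 pX (psd_sqr hK).
  have -> : (s%:C *: G - Q) *m (s%:C *: G - Q) =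
      (s ^+ 2)%:C *: 1%:M - s%:C *: (Q *m G + G *m Q) + Q.
    rewrite mulmxBr !mulmxBl -!scalemxAl -!scalemxAr GG QQ scalerA -rmorphM -expr2.
    move: (G *m Q) (Q *m G) => a b; apply/matrixP => i j; rewrite !mxE.
    move: (s%:C) => z; ring.
  rewrite rtrDr rtrBr !rtrZr {1}/rtr mulmx1 ss => hh.
  rewrite -(ler_pM2l s0); have -> : s * (2 * s) = 2 * s ^+ 2 by ring.
  rewrite ss; have : h * complex.Re (\tr X) <= h * 1 by rewrite ler_pM2l.
  move: hh hX; move: (complex.Re _) (rtr X Q) (rtr X _) => a b c; clear.
  by rewrite mulr1; move: (h * a) (s * c) => d e; lra.
have h2 : - rtr X (Q *m G *m Q) <= h.
  apply: le_trans hX; rewrite -rtrNr; apply: (rtr_le pX).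
  have -> : Q - - (Q *m G *m Q) = Q *m (1%:M + G) *m Q.
    by rewrite opprK mulmxDr mulmxDl mulmx1 QQ.
  rewrite -{2}hQ; apply: psd_conjV; exact: (proj2 (involution_bound hG GG)).
by apply: lerD.
Qed.

Definition bnat n (b : 'I_n -> bool) (i : 'I_n) : R := (b i)%:R.

(** Turns the number of nonzero eigenvalues into a rank, which does not grow under compression. For
    the lower bound, putting 1 at the zero entries gives an invertible diagonal, and rank is
    subadditive. *)
Lemma rank_udiag n (W : 'M[C]_n) x : is_unitary W ->
  \rank (udiag W x) = (\sum_i (x i != 0)%R)%N.
Proof.
move=> [W1 W2]; have -> : \rank (udiag W x) = \rank (rdiag x).
  apply/eqP; rewrite eqn_leq; apply/andP; split.
    by apply: leq_trans (mxrankM_maxl _ _) (mxrankM_maxr _ _).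
  have -> : rdiag x = W *m udiag W x *m adj W.
    by rewrite /udiag !mulmxA W2 mul1mx -mulmxA W2 mulmx1.
  by apply: leq_trans (mxrankM_maxl _ _) (mxrankM_maxr _ _).
have up (u : 'I_n -> R) : (\rank (rdiag u) <= \sum_i (u i != 0)%R)%N.
  rewrite /rdiag diag_mx_sum_delta.
  apply: (@leq_trans (\sum_i \rank ((\row_i (u i)%:C) 0 i *: delta_mx i i : 'M[C]_n)%R)%N).
    apply: (big_ind2 (fun (A : 'M[C]_n) k => (\rank A <= k)%N)) => //.
      by rewrite mxrank0.
    move=> A a B b hA hB; exact: leq_trans (mxrank_add A B) (leq_add hA hB).
  apply: leq_sum => i _; rewrite mxE; case: eqP => [->|_].
    by rewrite scale0r mxrank0.
  by apply: leq_trans (mxrank_scale _ _) _; rewrite mxrank_delta.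
apply/eqP; rewrite eqn_leq up /=.
pose u i : R := (x i == 0)%R%:R; pose z i := x i + u i.
have z0 i : z i != 0.
  by rewrite /z /u; case: (eqVneq (x i) 0) => [->|h]; rewrite ?add0r ?oner_eq0 ?addr0.
have : (n <= \rank (rdiag z))%N.
  rewrite -{1}(mxrank1 C n); have <- : rdiag z *m rdiag (fun i => (z i)^-1) = 1%:M.
    by rewrite rdiagM -(rdiag_scalar n 1); apply: eq_rdiag => i; rewrite divff.
  exact: mxrankM_maxl.
have -> : rdiag z = rdiag x + rdiag u by rewrite rdiagD.
move=> h; have {h} := leq_trans h (mxrank_add _ _).
move=> /leq_trans/(_ (leq_add (leqnn _) (up u))).
have {1}-> : n = (\sum_(i < n) (x i != 0)%R + \sum_(i < n) (u i != 0)%R)%N.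
  rewrite -big_split /= -[LHS]card_ord -sum1_card; apply: eq_bigr => i _.
  by rewrite /u; case: (eqVneq (x i) 0); rewrite ?oner_eq0 ?eqxx.
by rewrite leq_add2r.
Qed.

(** [X + 2 (1 - P)] separates the range of [P], where [X <= 1], from its complement. *)
Lemma codiag n (X P : 'M[C]_n) : is_hermitian X -> is_proj P -> P *m X = X -> X *m P = X ->
  is_psd (1%:M - X) ->
  exists W (b : 'I_n -> bool) p, [/\ is_unitary W, P = udiag W (bnat b), X = udiag W p &
    forall i, p i != 0 -> b i].
Proof.
move=> hX [hP PP] PX XP X1; pose K := X + (2%:C)%:M *m (1%:M - P).
have two : (2%:C)%:M *m (1%:M - P) = 2%:C *: (1%:M - P) by rewrite mul_scalar_mx.
have hK : is_hermitian K.
  by rewrite /K two; apply: hermD => //; rewrite /is_hermitian adjZ (hermB (@herm1 R n) hP).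
have [W [m [uW KE]]] := herm_spectral hK; have [W1 W2] := uW.
have WK i : row i W *m K = (m i)%:C *: row i W.
  rewrite KE /udiag -mulmxA -row_mul !mulmxA W2 mul1mx.
  rewrite /rdiag mul_diag_mx; apply/rowP => j; rewrite !mxE //.
have QK : K *m (1%:M - P) = 2%:C *: (1%:M - P).
  rewrite /K two mulmxDl -scalemxAl mulmxBr mulmx1 XP subrr add0r.
  by rewrite [X in 2%:C *: X](proj2 (proj_compl (conj hP PP))).
have PK : K *m P = X.
  by rewrite /K two mulmxDl XP -scalemxAl mulmxBl mul1mx PP subrr scaler0 addr0.
pose b i := m i != 2.
have WP i : row i W *m P = (bnat b i)%:C *: row i W.
  rewrite /bnat /b; case: eqVneq => [mi|mi].
    rewrite scale0r.
    (* A nonzero [w] would be an eigenvector of [X] for the value 2, contradicting [X <= 1]. *)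
    pose w := row i W *m P.
    have wX : w *m X = 2%:C *: w.
      by rewrite /w -mulmxA PX -PK mulmxA WK mi -scalemxAl.
    have := X1 (adj w); rewrite adjK mulmxBr mulmx1 wX mulmxBl -scalemxAl.
    have -> : w *m adj w - 2%:C *: (w *m adj w) = - (adj (adj w) *m adj w).
      by rewrite adjK; apply/matrixP => k l; rewrite !mxE; ring.
    rewrite mxE sqnE -rmorphN ler0c oppr_ge0 => h.
    have /sqn_eq0 : sqn (adj w) = 0 by apply/eqP; rewrite eq_le h sqn_ge0.
    by move=> /(congr1 adj); rewrite adjK adj0.
  rewrite scale1r; apply/eqP; rewrite eq_sym -subr_eq0; apply/eqP.
  (* The component off the range of [P] has eigenvalue 2 for [K], but also [m i], which differs from
     2; so it vanishes. *)
  have e : row i W - row i W *m P = row i W *m (1%:M - P) by rewrite mulmxBr mulmx1.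
  have h : (m i)%:C *: (row i W *m (1%:M - P)) = 2%:C *: (row i W *m (1%:M - P)).
    by rewrite scalemxAl -WK -mulmxA QK -scalemxAr.
  apply/eqP; rewrite e; move/eqP: h; rewrite -subr_eq0 -scalerBl scaler_eq0 => /orP[|//].
  rewrite -rmorphB fmorph_eq0 subr_eq0; by rewrite (negbTE mi).
have PE : P = udiag W (bnat b).
  suff e : W *m P = rdiag (bnat b) *m W by rewrite /udiag -mulmxA -e mulmxA W1 mul1mx.
  by apply/row_matrixP => i; rewrite row_mul WP /rdiag mul_diag_mx; apply/rowP => j; rewrite !mxE.
exists W, b, (fun i => m i * bnat b i); split => //.
  by rewrite -[LHS]PK KE PE udiagM.
by move=> i; rewrite /bnat; case: (b i) => //; rewrite mulr0 eqxx.
Qed.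

(** The typical cut comes first because it commutes with [rho] and fixes rank and largest
    eigenvalue; the compression by [P] afterwards can increase neither, and its result is diagonal
    together with [P]. *)
Lemma truncated_state D (rho W P : 'M[C]_D) x (v t h : R) :
  is_unitary W -> rho = udiag W x -> is_distr x -> lnvar x <= v -> 0 < t ->
  is_proj P -> 0 < h -> rtr rho (1%:M - P) <= h ->
  let S := entropy rho in let eta := v / t ^+ 2 + (2 * Num.sqrt h + h) in
  exists V (b : 'I_D -> bool) (p : 'I_D -> R),
    [/\ is_unitary V, P = udiag V (bnat b) & forall i, 0 <= p i] /\
    [/\ forall i, p i <= expR (- S + t), forall i, p i != 0 -> b i,
      \sum_i (p i != 0)%R%:R <= expR (S + t), 1 - eta <= \sum_i p i <= 1 &
      trnorm (rho - udiag V p) <= eta].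
Proof.
move=> uW rE dx vx t0 pP h0 hr S eta; have [x0 x1] := dx; have [hP PP] := pP.
have SE : S = - \sum_i x i * ln (x i) by rewrite /S rE entropy_udiag.
have [T [bT cT mT]] := typical_set dx vx t0; rewrite -SE in bT cT.
pose y i := x i * indic T i.
have y0 i : 0 <= y i by rewrite mulr_ge0 // ler0n.
have yx i : y i <= x i by rewrite ler_piMr // /indic lern1 leq_b1.
pose r1 := udiag W y.
have p1 : is_psd r1 by exact: psd_udiag.
have pd : is_psd (rho - r1).
  by rewrite rE udiagB; apply: psd_udiag => i; rewrite subr_ge0.
have t1 : complex.Re (\tr r1) <= 1.
  by rewrite mxtrace_udiag //= -x1; apply: ler_sum.
have pQ : is_psd (1%:M - P) := psd_proj (proj_compl pP).
have hr1 : rtr r1 (1%:M - P) <= h.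
  apply: le_trans hr; rewrite -subr_ge0 -rtrBl; exact: rtr_ge0 pd pQ.
pose r' := P *m r1 *m P.
have gm := gentle_measurement p1 t1 pP h0 hr1; rewrite -/r' in gm.
have pr' : is_psd r' by have := psd_conjV P p1; rewrite hP.
(* Decompose [c - P r1 P] as [c (1 - P) + P (c - r1) P]. *)
have bound c : 0 <= c -> (forall i, y i <= c) -> is_psd ((c%:C)%:M - r').
  move=> c0 yc.
  have e1 : is_psd ((c%:C)%:M - r1).
    rewrite -(udiag_scalar c uW) udiagB; apply: psd_udiag => i.
    by rewrite subr_ge0.
  have e2 := psd_compress hP e1.
  have e3 : is_psd ((c%:C)%:M - P *m (c%:C)%:M *m P).
    rewrite mul_mx_scalar -scalemxAl PP -scalemx1 -scalerBr.
    exact: psdZ c0 pQ.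
  by have := psdD e3 e2; rewrite addrA subrK.
have [V [b [p [uV PE XE pb]]]] : exists V (b : 'I_D -> bool) p,
    [/\ is_unitary V, P = udiag V (bnat b), r' = udiag V p & forall i, p i != 0 -> b i].
  apply: (codiag (psd_herm pr') pP).
  - by rewrite /r' !mulmxA PP.
  - by rewrite /r' -!mulmxA PP.
  - by apply: (bound 1 ler01) => i; apply: le_trans (yx i) (distr_le1 i dx).
have p0 i : 0 <= p i by apply: (psd_udiag_ge0 uV); rewrite -XE.
have trn : trnorm (rho - udiag V p) <= eta.
  rewrite -XE (_ : rho - r' = (rho - r1) + (r1 - r')); last by rewrite addrA subrK.
  apply: le_trans (trnormD _ _) _.
  - exact: psd_herm pd.
  - by apply: hermB; exact: psd_herm.
  apply: lerD => //; rewrite rE udiagB trnorm_udiag //; apply: le_trans mT.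
  rewrite [leRHS]big_mkcond /=; apply: ler_sum => i _; rewrite /y /indic.
  by case: (i \in T); rewrite ?mulr1 ?subrr ?normr0 ?mulr0 ?subr0 // ger0_norm.
exists V, b, p; split; first by split.
split => //.
- move=> i; rewrite -subr_ge0; move: i; apply: (psd_udiag_ge0 uV).
  rewrite -udiagB -XE (udiag_scalar _ uV); apply: bound; first exact: expR_ge0.
  move=> i; rewrite /y /indic; case: (boolP (i \in T)) => iT; last by rewrite mulr0 expR_ge0.
  by rewrite mulr1 bT.
- apply: le_trans cT; rewrite -natr_sum ler_nat -(rank_udiag p uV) -XE.
  apply: (@leq_trans (\rank r1)).
    by apply: leq_trans (mxrankM_maxl _ _) (mxrankM_maxr _ _).
  rewrite rank_udiag // -sum1_card [leqRHS]big_mkcond /=; apply: leq_sum => i _.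
  by rewrite /y /indic; case: (i \in T); rewrite ?leq_b1 // mulr0 eqxx.
- apply/andP; split.
    rewrite lerBlDr addrC -lerBlDr -x1 -sumrB; apply: le_trans trn.
    have hd : is_hermitian (rho - udiag V p).
      by apply: hermB; rewrite ?rE; exact: adj_udiag.
    have := trnorm_dual hd (involution_bound (@herm1 R D) (mul1mx _)).
    rewrite mul1r; apply: le_trans; apply: le_trans (ler_norm _).
    by rewrite rtrBl rE /rtr !mulmx1 !mxtrace_udiag //= sumrB.
  have : rtr r' 1%:M <= 1.
    apply: le_trans t1; rewrite /r' -{2}hP rtr_conj mulmx1 hP PP.
    have := rtr_ge0 p1 pQ; rewrite rtrBr subr_ge0 => /le_trans; apply.
    by rewrite /rtr mulmx1.
  by rewrite XE /rtr mulmx1 mxtrace_udiag.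
Qed.

End Truncation.

(** * Construction of the almost-commuting unitary *)

Section Construction.
Local Open Scope complex_scope.
Context {R : realType}.
Local Notation C := R[i].
Implicit Types (m n D N : nat) (r : R).

(** The last clause is Markov's inequality in operator form. *)
Lemma low_energy_projector n (B : 'M[C]_n) (e : R) : is_psd B -> 0 < e ->
  exists P, [/\ is_proj P, is_psd ((e%:C)%:M - P *m B *m P) & is_psd (B - e%:C *: (1%:M - P))].
Proof.
move=> /psd_spectral[W [b [uW -> b0]]] e0.
pose f i : R := (b i <= e)%R%:R.
have fZ : e%:C *: (1%:M - udiag W f) = udiag W (fun i => e * (1 - f i)).
  rewrite -(udiag_scalar 1 uW) udiagB /udiag scalemxAl scalemxAr; congr (_ *m _ *m _).
  apply/matrixP => i j; rewrite mxE !rdiagE rmorphM.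
  by case: (i == j); rewrite ?mulr0n ?mulr0.
exists (udiag W f); split.
- split; first exact: adj_udiag.
  rewrite (udiagM _ _ uW); apply: eq_udiag => i; rewrite /f.
  by case: (b i <= e); rewrite ?mulr0 ?mulr1.
- rewrite !udiagM // -(udiag_scalar e uW) udiagB; apply: psd_udiag => i; rewrite /f.
  by case: (boolP (b i <= e)) => h; rewrite ?mulr1 ?mul1r ?mulr0 ?subr0 ?subr_ge0 // ltW.
- rewrite fZ udiagB; apply: psd_udiag => i; rewrite /f.
  case: (boolP (b i <= e)) => h; rewrite ?subrr ?mulr0 ?subr0 //.
  by rewrite mulr1 subr_ge0 ltW // ltNge.
Qed.

Lemma sqnD_le n (u w : 'cV[C]_n) : sqn (u + w) <= 2 * sqn u + 2 * sqn w.
Proof.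
pose f (a b : 'cV[C]_n) := complex.Re ((adj a *m b) 0 0).
have fDl a b c : f (a + b) c = f a c + f b c by rewrite /f adjD mulmxDl mxE ReD.
have fDr a b c : f c (a + b) = f c a + f c b by rewrite /f mulmxDr mxE ReD.
have fNl a c : f (- a) c = - f a c by rewrite /f adjN mulNmx mxE ReN.
have fNr a c : f c (- a) = - f c a by rewrite /f mulmxN mxE ReN.
have := sqn_ge0 (u - w); rewrite /sqn -!/(f _ _) !(fDl, fDr, fNl, fNr).
move: (f u u) (f w w) (f u w) (f w u) => p q s t; lra.
Qed.

(** The shift by [a] drops out of the commutator, and [U - 1 = (U0 - 1) P]. So only [P Z] and [Z P],
    each with or without [U0], remain: four terms of norm at most [sqrt e]. The hypothesis controls
    [Z P]; [gram_spectral] transfers it to [P Z]. *)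
Lemma comm_bound n (A P U0 : 'M[C]_n) (a e : R) :
  is_hermitian A -> is_proj P -> 0 < e -> is_unitary U0 -> U0 *m P = P *m U0 ->
  is_psd ((e%:C)%:M - P *m ((A - (a%:C)%:M) *m (A - (a%:C)%:M)) *m P) ->
  forall U, U = U0 *m P + (1%:M - P) ->
  opnorm (U *m A - A *m U) <= 4 * Num.sqrt e.
Proof.
move=> hA [hP PP] e0 uU0 UP h U UE; have [U1 U2] := uU0.
set Z := A - (a%:C)%:M in h; have hZ : is_hermitian Z.
  by apply: hermB => //; rewrite /is_hermitian adj_scalar.
have UZ : U *m A - A *m U = U *m Z - Z *m U.
  by rewrite /Z mulmxBr mulmxBl mul_mx_scalar mul_scalar_mx opprB addrA subrK.
clearbody Z; pose Y := Z *m P.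
have YE : adj Y = P *m Z by rewrite /Y adjM hP hZ.
have h1 : is_psd ((e%:C)%:M - adj Y *m Y).
  by rewrite (_ : adj Y *m Y = P *m (Z *m Z) *m P) // YE /Y !mulmxA.
have h2 := gram_spectral e0 h1; rewrite -[X in X *m _](adjK Y) in h2.
have {}h1 := (psd_gram_bound e Y).1 h1.
have {}h2 := (psd_gram_bound e (adj Y)).1 h2.
have isoU v : sqn (U0 *m v) = sqn v.
  by rewrite /sqn adjM mulmxA -(mulmxA (adj v)) U1 mulmx1.
have KE : U *m A - A *m U = (U0 *m adj Y + - adj Y) + (- (Y *m U0) + Y).
  rewrite UZ UE mulmxDl mulmxDr mulmxBl mulmxBr mul1mx mulmx1 YE /Y.
  rewrite -(mulmxA Z P) -UP mulmxA -(mulmxA U0 P Z) opprD opprB.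
  rewrite mulmxA; move: (U0 *m (P *m Z)) (P *m Z) (Z *m P) (Z *m U0 *m P) => q1 q2 q3 q4.
  by apply/matrixP => i j; rewrite !mxE; ring.
clearbody Y; apply: opnorm_le; first by rewrite mulr_ge0 // sqrtr_ge0.
rewrite exprMn (sqr_sqrtr (ltW e0)); apply: (psd_gram_bound (4 ^+ 2 * e) (U *m A - A *m U)).2 => v.
rewrite KE !mulmxDl !mulNmx -!mulmxA.
have sN n' (u : 'cV[C]_n') : sqn (- u) = sqn u by rewrite /sqn adjN mulNmx mulmxN opprK.
have b1 := sqnD_le (U0 *m (adj Y *m v) + - (adj Y *m v)) (- (Y *m (U0 *m v)) + Y *m v).
have b2 := sqnD_le (U0 *m (adj Y *m v)) (- (adj Y *m v)).
have b3 := sqnD_le (- (Y *m (U0 *m v))) (Y *m v).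
have b4 := h2 v; have b5 := h1 v; have b6 := h1 (U0 *m v).
rewrite sN isoU in b2; rewrite sN in b3; rewrite isoU in b6.
apply: (le_trans b1); have -> : 4 ^+ 2 * e * sqn v = 16 * (e * sqn v) by ring.
move: b2 b3 b4 b5 b6; move: (e * _) (sqn _) (sqn _) (sqn _) (sqn _) (sqn _) => q1 q2 q3 q4 q5 q6.
lra.
Qed.

Lemma unitary_block n (P U0 : 'M[C]_n) : is_proj P -> is_unitary U0 -> U0 *m P = P *m U0 ->
  is_unitary (U0 *m P + (1%:M - P)).
Proof.
move=> pP [U1 U2] UP; have [hP PP] := pP; have [hQ QQ] := proj_compl pP.
set Q := 1%:M - P in hQ QQ *.
have PQ : P *m Q = 0 by rewrite mulmxBr mulmx1 PP subrr.
have QP : Q *m P = 0 by rewrite mulmxBl mul1mx PP subrr.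
have UP' : adj U0 *m P = P *m adj U0.
  by have := congr1 adj UP; rewrite !adjM hP => ->.
have PQ1 : P + Q = 1%:M by rewrite addrC subrK.
clearbody Q; rewrite /Defs.is_unitary adjD adjM hP hQ; split.
  have e1 : P *m adj U0 *m (U0 *m P) = P.
    by rewrite mulmxA -(mulmxA P) U1 mulmx1 PP.
  have e2 : P *m adj U0 *m Q = 0 by rewrite -UP' -mulmxA PQ mulmx0.
  have e3 : Q *m (U0 *m P) = 0 by rewrite UP mulmxA QP mul0mx.
  by rewrite mulmxDl !mulmxDr e1 e2 e3 QQ addr0 add0r.
have e1 : U0 *m P *m (P *m adj U0) = P.
  by rewrite mulmxA -(mulmxA U0) PP UP -mulmxA U2 mulmx1.
have e2 : U0 *m P *m Q = 0 by rewrite -mulmxA PQ mulmx0.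
have e3 : Q *m (P *m adj U0) = 0 by rewrite mulmxA QP mul0mx.
by rewrite mulmxDl !mulmxDr e1 e2 e3 QQ addr0 add0r.
Qed.

Lemma perm_mx_conj n (s : {perm 'I_n}) (z : 'I_n -> R) :
  adj (perm_mx s) *m rdiag z *m perm_mx s = rdiag (fun k => z (s^-1%g k)) :> 'M[C]_n.
Proof.
have -> : adj (perm_mx s : 'M[C]_n) = perm_mx s^-1.
  rewrite /adj map_perm_mx tr_perm_mx //.
rewrite -row_permE -[X in _ *m perm_mx X]invgK -col_permE.
apply/matrixP => i j; rewrite !mxE (inj_eq (@perm_inj _ _)).
by case: eqP.
Qed.

Lemma perm_mx_unitary n (s : {perm 'I_n}) : is_unitary (perm_mx s : 'M[C]_n).
Proof.
have E : adj (perm_mx s : 'M[C]_n) = perm_mx s^-1 by rewrite /adj map_perm_mx tr_perm_mx.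
by split; rewrite E -perm_mxM ?mulVg ?mulgV perm_mx1.
Qed.

End Construction.

(** * The unitary for one fixed number of sites *)

Section Assembly.
Local Open Scope complex_scope.
Context {R : realType}.
Local Notation C := R[i].
Implicit Types (m n D N : nat) (r : R).

Lemma proj_tens m n (P : 'M[C]_m) : is_proj P -> is_proj (P *t (1%:M : 'M[C]_n)).
Proof.
move=> [hP PP]; split; first exact: herm_tens hP (@herm1 R n).
by rewrite tensmx_mul PP mulmx1.
Qed.

Lemma conj_block n (P U0 U X : 'M[C]_n) : U = U0 *m P + (1%:M - P) -> is_hermitian X ->
  P *m X = X -> U *m X *m adj U = U0 *m X *m adj U0.
Proof.
move=> UE hX PX.
have UX : U *m X = U0 *m X.
  by rewrite UE mulmxDl mulmxBl mul1mx PX subrr addr0 -mulmxA PX.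
have XU : X *m adj U = X *m adj U0 by have := congr1 adj UX; rewrite !adjM hX.
by rewrite UX -mulmxA XU mulmxA.
Qed.

Lemma perm_conj_udiag n (W V U : 'M[C]_n) (s : {perm 'I_n}) z : is_unitary W ->
  U = adj V *m adj (perm_mx s) *m W ->
  U *m udiag W z *m adj U = udiag V (fun k => z (s^-1%g k)).
Proof.
move=> [_ w] ->; rewrite [RHS]/udiag -perm_mx_conj !adjM !adjK /udiag !mulmxA.
by rewrite -!(mulmxA _ W (adj W)) w !mulmx1.
Qed.

Lemma udiag_tens1 m n (W : 'M[C]_m) z :
  udiag W z *t (1%:M : 'M[C]_n) = udiag (W *t (1%:M : 'M[C]_n)) (fun k => z (mxtens_unindex k).1).
Proof.
have e : udiag (1%:M : 'M[C]_n) (fun=> 1) = 1%:M by rewrite udiag1 rdiag_scalar.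
by rewrite -{1}e udiag_tens; apply: eq_udiag => k; rewrite mulr1.
Qed.

(** The low-energy subspace of [\sum_j (A_j - a_j)^2] replaces a joint spectral subspace of the
    non-commuting charges. *)
Lemma microcanonical_projector D c (A : 'I_c -> 'M[C]_D) (a : 'I_c -> R) (e : R) :
  (forall j, is_hermitian (A j)) -> 0 < e ->
  let Z j := A j - ((a j)%:C)%:M in
  exists P, [/\ is_proj P, forall j, is_psd ((e%:C)%:M - P *m (Z j *m Z j) *m P) &
    forall rho h, is_psd rho -> \sum_j rtr rho (Z j *m Z j) <= e * h ->
      rtr rho (1%:M - P) <= h].
Proof.
move=> hA e0 Z.
have hZ j : is_hermitian (Z j) by apply: hermB => //; rewrite /is_hermitian adj_scalar.
have pZ j : is_psd (Z j *m Z j) := psd_sqr (hZ j).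
pose B := \sum_j Z j *m Z j.
have pB : is_psd B by apply: psd_sum => k _; exact: pZ.
have [P [pP b1 b2]] := low_energy_projector pB e0; have [hP _] := pP.
exists P; split; [exact: pP|move=> j|move=> rho h pr hh].
  have hj : is_psd (B - Z j *m Z j).
    rewrite /B (bigD1 j isT) addrAC subrr add0r; apply: psd_sum => k _; exact: pZ.
  by have := psdD b1 (psd_compress hP hj); rewrite addrA subrK.
rewrite -(ler_pM2l e0); apply: le_trans hh.
by rewrite -rtr_sumr -rtrZr; exact: rtr_le pr b2.
Qed.

Lemma transform_exists D N c (A : 'I_c -> 'M[C]_D) (a : 'I_c -> R)
  (rho sigma W V : 'M[C]_D) x y (v t h e : R) :
  let Z j := A j - ((a j)%:C)%:M in
  let w := rdiag (@embez R N) in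
  (0 < N)%N -> (forall j, is_hermitian (A j)) ->
  is_unitary W -> rho = udiag W x -> is_distr x -> lnvar x <= v ->
  is_unitary V -> sigma = udiag V y -> is_distr y -> lnvar y <= v ->
  0 < t -> `|entropy rho - entropy sigma| <= t -> 0 < h -> 0 < e ->
  \sum_j rtr rho (Z j *m Z j) <= e * h -> \sum_j rtr sigma (Z j *m Z j) <= e * h ->
  exists U : 'M[C]_(D * N), [/\ is_unitary U,
    forall j, opnorm (U *m (A j *t 1%:M) - (A j *t 1%:M) *m U) <= 4 * Num.sqrt e &
    trnorm (U *m (rho *t w) *m adj U - sigma *t w) <=
      4 * (v / t ^+ 2 + (2 * Num.sqrt h + h)) + (6 + 8 * t) / ln N.+1%:R].
Proof.
move=> Z w N0 hA uW rE dx vx uV sE dy vy t0 St h0 e0 hr hs.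
have [P [pP PZ Ph]] := microcanonical_projector a hA e0.
have sr : is_state rho by rewrite rE; exact: state_udiag.
have ss : is_state sigma by rewrite sE; exact: state_udiag.
have Pr : rtr rho (1%:M - P) <= h := Ph _ _ (proj1 sr) hr.
have Ps : rtr sigma (1%:M - P) <= h := Ph _ _ (proj1 ss) hs.
have [W1 [b [p [[uW1 PE p0] [pM pb pL sp trp]]]]] := truncated_state uW rE dx vx t0 pP h0 Pr.
have [V1 [b' [q [[uV1 PE' q0] [qM qb qL sq trq]]]]] := truncated_state uV sE dy vy t0 pP h0 Ps.
set eta := v / t ^+ 2 + _ in sp trp sq trq *.
set S := entropy rho in St pM pL; set S' := entropy sigma in St qM qL.
clearbody S S' eta.
have /andP[St1 St2] : - t <= S - S' <= t by rewrite -ler_norml.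
(* The entropies differ by at most [t], so doubling the width gives both states the same bounds.
   Then [ln (M * L) = 4 t], the origin of [6 + 8 t]. *)
pose M := expR (- S + 2 * t); pose L := expR (S + 2 * t).
have ML : M * L = expR (4 * t) by rewrite -expRD; congr expR; ring.
have pM' i : p i <= M by apply: le_trans (pM i) _; rewrite ler_expR; clear -t0 St1 St2; lra.
have qM' i : q i <= M by apply: le_trans (qM i) _; rewrite ler_expR; clear -t0 St1 St2; lra.
have pL' : \sum_i (p i != 0)%R%:R <= L by apply: le_trans pL _; rewrite ler_expR; clear -t0 St1 St2; lra.
have qL' : \sum_i (q i != 0)%R%:R <= L by apply: le_trans qL _; rewrite ler_expR; clear -t0 St1 St2; lra.
(* Both bases diagonalise the same [P], so both counts equal its trace. *)
have cb : \sum_i (b i : nat) = \sum_i (b' i : nat).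
  apply/eqP; rewrite -(eqr_nat R) !raddf_sum /=; apply/eqP.
  have := congr1 (fun X => complex.Re (\tr X)) (etrans (esym PE) PE').
  by rewrite !mxtrace_udiag.
have ML1 : 1 <= M * L.
  by rewrite ML; apply: le_trans (expR_ge1Dx _); rewrite lerDl mulr_ge0 // ltW.
have [s [sb sl1]] := embezzle_match N0 (expR_gt0 _) ML1 p0 pM' pb sp pL' q0 qM' qb sq qL' cb.
pose i1 : 'M[C]_N := 1%:M.
pose U0 := (adj V1 *t i1) *m adj (perm_mx s) *m (W1 *t i1).
have u1 : is_unitary i1 := unitary1 N.
have uW1i : is_unitary (W1 *t i1) := unitary_tens uW1 u1.
have uV1i : is_unitary (V1 *t i1) := unitary_tens uV1 u1.
have uS : is_unitary (perm_mx s : 'M[C]__) := perm_mx_unitary s.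
have aV : adj V1 *t i1 = adj (V1 *t i1) by rewrite adj_tens adjmx1.
have uU0 : is_unitary U0.
  by rewrite /U0 aV; exact: unitaryM (unitaryM (unitary_adj uV1i) (unitary_adj uS)) uW1i.
have U0udiag z : U0 *m udiag (W1 *t i1) z *m adj U0 = udiag (V1 *t i1) (fun k => z (s^-1%g k)).
  by apply: (perm_conj_udiag (s := s) z uW1i); rewrite -aV.
pose PT := P *t i1; have pPT : is_proj PT := proj_tens N pP.
have PTE : PT = udiag (W1 *t i1) (fun k => bnat b (mxtens_unindex k).1).
  by rewrite -udiag_tens1 -PE.
have PTE' : PT = udiag (V1 *t i1) (fun k => bnat b' (mxtens_unindex k).1).
  by rewrite -udiag_tens1 -PE'.
have U0P : U0 *m PT = PT *m U0.
  have e1 : U0 *m PT *m adj U0 = PT.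
    rewrite {1}PTE U0udiag PTE'; apply: eq_udiag => k.
    by rewrite /bnat -sb permKV.
  by rewrite -{2}e1 -mulmxA (proj1 uU0) mulmx1.
pose U := U0 *m PT + (1%:M - PT).
have uU : is_unitary U := unitary_block pPT uU0 U0P.
exists U; split; [exact: uU|move=> j|].
  apply: (@comm_bound R _ _ PT U0 (a j) e) => //; first exact: herm_tens (hA j) (@herm1 R N).
  have -> : A j *t 1%:M - ((a j)%:C)%:M = Z j *t i1.
    by rewrite /Z tensmxBl tensmx_scalar1.
  rewrite /PT !tensmx_mul !mulmx1 -(tensmx_scalar1 D N) -tensmxBl.
  exact: psd_tens (PZ j) (@psd1 R N).
have dw : is_distr (@embez R N) := embez_distr N0.
have wE z (T : 'M[C]_D) : udiag T z *t w = udiag (T *t i1) (tens_distr z (@embez R N)).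
  by rewrite /w -udiag1 udiag_tens.
have hw : is_hermitian w by exact: adj_rdiag.
have hrp : is_hermitian (rho - udiag W1 p) := hermB (state_herm sr) (adj_udiag W1 p).
have hsq : is_hermitian (sigma - udiag V1 q) := hermB (state_herm ss) (adj_udiag V1 q).
have hpw : is_hermitian (udiag W1 p *t w) := herm_tens (adj_udiag W1 p) hw.
have Ppw : PT *m (udiag W1 p *t w) = udiag W1 p *t w.
  rewrite PTE wE (udiagM _ _ uW1i); apply: eq_udiag => k; rewrite /bnat /tens_distr.
  case: (eqVneq (p (mxtens_unindex k).1) 0) => [->|/pb ->]; first by rewrite !mul0r mulr0.
  by rewrite mul1r.
have e1 : U *m (udiag W1 p *t w) *m adj U =
    udiag (V1 *t i1) (fun k => tens_distr p (@embez R N) (s^-1%g k)).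
  by rewrite (conj_block (erefl U) hpw Ppw) wE U0udiag.
(* Two truncation errors [eta] and one matching error, which itself contains [2 * eta]. *)
have dec : U *m (rho *t w) *m adj U - sigma *t w =
   U *m ((rho - udiag W1 p) *t w) *m adj U +
   ((U *m (udiag W1 p *t w) *m adj U - udiag V1 q *t w) + - ((sigma - udiag V1 q) *t w)).
  rewrite !tensmxBl mulmxBr mulmxBl.
  move: (U *m (rho *t w) *m adj U) (U *m _ *m _) (udiag V1 q *t w) (sigma *t w).
  by move=> q1 q2 q3 q4; apply/matrixP => k l; rewrite !mxE; ring.
rewrite {}dec e1 wE udiagB.
set X1 := U *m _ *m _; set X2 := udiag _ _; set X3 := (sigma - _) *t w.
have hX1 : is_hermitian X1 := herm_conj U (herm_tens hrp hw).
have hX2 : is_hermitian X2 by exact: adj_udiag.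
have hX3 : is_hermitian X3 := herm_tens hsq hw.
have hX3' : is_hermitian (- X3) by rewrite /is_hermitian adjN hX3.
have n1 : trnorm X1 <= eta.
  by rewrite (trnorm_conj uU (herm_tens hrp hw)) (trnorm_tens_rdiag hrp (proj1 dw) (proj2 dw)).
have n3 : trnorm (- X3) <= eta.
  by rewrite (trnormN hX3) (trnorm_tens_rdiag hsq (proj1 dw) (proj2 dw)).
have n2 : trnorm X2 <= 2 * (3 + ln (M * L)) / ln N.+1%:R + 2 * eta.
  rewrite (trnorm_udiag _ uV1i) (reindex_perm s) /=; apply: le_trans sl1.
  by apply: ler_sum => k _; rewrite permK.
clearbody X1 X2 X3; have t1 := trnormD hX1 (hermD hX2 hX3'); have t2 := trnormD hX2 hX3'.
apply: (le_trans t1).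
have -> : 4 * eta + (6 + 8 * t) / ln N.+1%:R =
    eta + ((2 * (3 + ln (M * L)) / ln N.+1%:R + 2 * eta) + eta).
  by rewrite ML expRK; ring.
exact: (lerD n1 (le_trans t2 (lerD n2 n3))).
Qed.

End Assembly.

(** * Asymptotics *)

Section Asymptotics.
Local Open Scope complex_scope.
Context {R : realType}.
Local Notation C := R[i].

Lemma cvg0P (f : nat -> R) : (forall n, 0 <= f n) ->
  (f @ \oo --> (0 : R)) <-> (forall eps, 0 < eps -> \forall n \near \oo, f n <= eps).
Proof.
move=> f0; split.
  move=> /cvgrPdist_le h eps e0; near=> n.
  have : `|0 - f n| <= eps by near: n; exact: h.
  by rewrite sub0r normrN ger0_norm.
move=> h; apply/cvgrPdist_le => eps e0; near=> n.
by rewrite sub0r normrN ger0_norm //; near: n; exact: h.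
Unshelve. all: by end_near.
Qed.

(** At each [n] the choice meets every attainable accuracy among the first [n] levels [1 / m.+1]. A
    fixed level is attainable for all large [n], hence eventually met. *)
Lemma diagonal_choice (T : nat -> Type) (G : forall n, T n -> Prop)
    (Q : R -> forall n, T n -> Prop) :
  (forall e e' n x, e <= e' -> Q e n x -> Q e' n x) ->
  (forall n, exists x, G n x) ->
  (forall e, 0 < e <= 1 -> \forall n \near \oo, exists x, G n x /\ Q e n x) ->
  exists x : forall n, T n, (forall n, G n (x n)) /\
    forall e, 0 < e -> \forall n \near \oo, Q e n (x n).
Proof.
move=> Qmono Gex Qex.
pose e_ m : R := m.+1%:R^-1.
have e_le m k : (m <= k)%N -> e_ k <= e_ m.
  by move=> mk; rewrite lef_pV2 ?posrE ?ltr0n // ler_nat.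
(* By monotonicity a witness for level [k] serves all coarser levels; if there is none, the previous
   choice is kept. *)
have best n k : exists x, G n x /\
    forall m, (m < k)%N -> (exists y, G n y /\ Q (e_ m) n y) -> Q (e_ m) n x.
  elim: k => [|k [x [Gx Qx]]]; first by have [x Gx] := Gex n; exists x.
  have [[y [Gy Qy]]|no] := pselect (exists y, G n y /\ Q (e_ k) n y).
    by exists y; split => // m; rewrite ltnS => /e_le mk _; exact: Qmono mk Qy.
  exists x; split => // m; rewrite ltnS leq_eqVlt => /orP[/eqP->//|]; exact: Qx.
pose x n := projT1 (cid (best n n)).
have xP n := projT2 (cid (best n n)); rewrite -/(x _) in xP.
exists x; split=> [n|e e0]; first by case: (xP n).
have [m me] : exists m, e_ m <= e.
  exists (Num.truncn e^-1); rewrite /e_ -[leRHS]invrK lef_pV2 ?posrE ?invr_gt0 ?ltr0n //.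
  by rewrite ltW // truncnS_gt.
have em : 0 < e_ m <= 1 by rewrite invr_gt0 ltr0n invf_le1 ?ltr0n // ler1n.
near=> n; apply: (Qmono (e_ m)) => //.
apply: (proj2 (xP n)); first by near: n; exact: nbhs_infty_gt.
by near: n; exact: Qex.
Unshelve. all: by end_near.
Qed.

(** Bundles the ancilla dimension with the matrices whose types depend on it, so that all are chosen
    at once for each [n]. *)
Record protocol D := Protocol {
  anc : nat;
  out_state : 'M[C]_anc;
  in_state : 'M[C]_anc;
  transf : 'M[C]_(D * anc) }.

Definition valid_protocol D (x : protocol D) :=
  [/\ is_state (out_state x), is_state (in_state x) & is_unitary (transf x)].

Definition good_protocol D c (A : 'I_c -> 'M[C]_D) (rho sigma : 'M[C]_D) (e n : R)
    (x : protocol D) :=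
  let U := transf x in
  [/\ ln (anc x)%:R <= e * n,
      forall j, opnorm (U *m (A j *t 1%:M) - (A j *t 1%:M) *m U) <= e * n &
      trnorm (U *m (rho *t in_state x) *m adj U - sigma *t out_state x) <= e].

Lemma good_protocol_mono D c (A : 'I_c -> 'M[C]_D) rho sigma (e e' n : R) x : 0 <= n ->
  e <= e' -> good_protocol A rho sigma e n x -> good_protocol A rho sigma e' n x.
Proof.
move=> n0 ee [h1 h2 h3]; split.
- by apply: le_trans h1 _; exact: ler_wpM2r.
- by move=> j; apply: le_trans (h2 j) _; exact: ler_wpM2r.
- exact: le_trans h3 ee.
Qed.

Lemma state_rdiag_embez N : (0 < N)%N -> is_state (rdiag (@embez R N)).
Proof.
by move=> N0; rewrite -udiag1; apply: state_udiag; [exact: unitary1|exact: embez_distr].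
Qed.

(** A fallback with one-dimensional ancilla, for those [n] at which no accuracy is available yet. *)
Lemma valid_protocol_exists D : exists x : protocol D, valid_protocol x.
Proof.
exists (@Protocol D 1 (rdiag (@embez R 1)) (rdiag (@embez R 1)) 1%:M).
split; [exact: state_rdiag_embez|exact: state_rdiag_embez|exact: unitary1].
Qed.

Lemma cabs_tr_diff n (X Y A : 'M[C]_n) : is_state X -> is_state Y -> is_hermitian A ->
  cabs (\tr (X *m A) - \tr (Y *m A)) = `|rtr X A - rtr Y A|.
Proof.
move=> /state_herm hX /state_herm hY hA; rewrite !herm_rtr //.
by rewrite -rmorphB cabs_real.
Qed.

Lemma good_protocol_near d c (A : 'I_c -> 'M[C]_d) (rho sigma : nat -> 'M[C]_d) (e : R) :
  (forall j, is_hermitian (A j)) ->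
  (forall i, is_state (rho i)) -> (forall i, is_state (sigma i)) ->
  asym_equiv A rho sigma -> 0 < e <= 1 ->
  \forall n \near \oo, exists x, valid_protocol x /\
    good_protocol (fun j => charge (A j) n) (prodst rho n) (prodst sigma n) e n%:R x.
Proof.
move=> hA hr hs [hS hch] /andP[e0 e1].
have {}hS := (cvg0P (fun n => divr_ge0 (normr_ge0 _) (ler0n _ _))).1 hS.
have cabs0 (z : C) : 0 <= cabs z by rewrite /cabs normc_def /= sqrtr_ge0.
have {}hch j := (cvg0P (fun n => divr_ge0 (cabs0 _) (ler0n _ _))).1 (hch j).
(* The final error is [4 (n v0 / t^2 + (2 s + h)) + (6 + 8 t) / ln N.+1]. Each term of the bracket
   receives [e / 16], as [3 s = e / 16]; the fraction receives [e / 2], of which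
   [8 delta / e = e / 4]. *)
pose s := e / 48; pose h := s ^+ 2; pose delta := e ^+ 2 / 32.
(* Makes the [c] squared biases sum to at most [(e n)^2 h / 36], below half of [thr * h]; [c.+1]
   avoids dividing by 0 when there are no charges. *)
pose tau := e * s / (6 * c.+1%:R).
pose K := \sum_j opnorm (A j) ^+ 2.
pose v0 : R := d%:R * 4.
have s0 : 0 < s by rewrite divr_gt0.
have h0 : 0 < h by rewrite exprn_gt0.
have d0 : 0 < delta by rewrite divr_gt0 // exprn_gt0.
have tau0 : 0 < tau by rewrite divr_gt0 ?mulr_gt0 ?ltr0n.
have K0 : 0 <= K by apply: sumr_ge0 => j _; exact: sqr_ge0.
near=> n.
have n0 : (0 < n)%N by near: n; exact: nbhs_infty_gt.
have nR : (0 : R) < n%:R by rewrite ltr0n.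
have n1 : 16 * v0 / (delta ^+ 2 * e) <= n%:R by near: n; exact: nbhs_infty_ger.
have n2 : 24 / e ^+ 2 <= n%:R by near: n; exact: nbhs_infty_ger.
have n3 : 32 * K / (e ^+ 2 * h) <= n%:R by near: n; exact: nbhs_infty_ger.
have Sn : `|entropy (prodst rho n) - entropy (prodst sigma n)| / n%:R <= delta.
  by near: n; exact: hS.
have cn : forall j, cabs (\tr (prodst rho n *m charge (A j) n) -
    \tr (prodst sigma n *m charge (A j) n)) / n%:R <= tau.
  by near: n; apply: filter_forall => j; exact: hch.
have [k nE] : exists k, n = k.+1 by exists n.-1; rewrite prednK.
rewrite nE /= in n0 nR n1 n2 n3 Sn cn *; set x := k.+1%:R in nR n1 n2 n3 Sn cn *.
have [W [p [uW rE dp vp]]] := prodst_rec_spectral k hr.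
have [V [q [uV sE dq vq]]] := prodst_rec_spectral k hs.
have sr := state_prodst_rec k hr; have ss := state_prodst_rec k hs.
set r := prodst_rec rho k in rE sr Sn cn *.
set sg := prodst_rec sigma k in sE ss Sn cn *.
pose B j := charge_rec (A j) k.
have hB j : is_hermitian (B j) := charge_rec_herm k (hA j).
(* Both states use the means of [rho] as reference; asymptotic equivalence bounds the bias of
   [sigma] by [tau * n]. *)
pose a j := rtr r (B j).
(* The integer part of [exp (e n)]: then [ln N <= e n <= ln N.+1], which is why the error is stated
   with [N.+1]. *)
pose N := Num.truncn (expR (e * x)).
have ex0 : 0 <= e * x by rewrite mulr_ge0 ?ltW.
have N0 : (0 < N)%N by rewrite truncn_gt0 -[leLHS]expR0 ler_expR.
have lnN : ln (N%:R : R) <= e * x.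
  rewrite -[leRHS]expRK ler_ln ?posrE ?ltr0n ?expR_gt0 //.
  by rewrite truncn_le ?expR_ge0.
have lnN1 : e * x <= ln (N.+1%:R : R).
  rewrite -[leLHS]expRK ler_ln ?posrE ?ltr0n ?expR_gt0 //.
  by rewrite ltW // truncnS_gt.
(* Chosen so that the commutator bound [4 * Num.sqrt thr] equals [e * x]. *)
pose t := delta * x; pose thr := (e * x / 4) ^+ 2.
have t0 : 0 < t by rewrite mulr_gt0.
have thr0 : 0 < thr by rewrite exprn_gt0 // divr_gt0 // mulr_gt0.
have qv (X : nat -> 'M[C]_d) : (forall i, is_state (X i)) ->
    \sum_j qvar (prodst_rec X k) (B j) <= x * K.
  by move=> hX; rewrite mulr_sumr; apply: ler_sum => j _; exact: qvar_prodst.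
have main1 : x * K <= thr * h / 2.
  have : 32 * K <= x * (e ^+ 2 * h) by rewrite -ler_pdivrMr // mulr_gt0 // exprn_gt0.
  have -> : thr * h / 2 = x * (x * (e ^+ 2 * h) / 32) by rewrite /thr; field.
  by rewrite ler_pM2l // ler_pdivlMr // [K * 32]mulrC.
have hr' : \sum_j rtr r ((B j - ((a j)%:C)%:M) *m (B j - ((a j)%:C)%:M)) <= thr * h.
  under eq_bigr do rewrite (rtr_centered _ _ sr) subrr expr0n addr0.
  apply: le_trans (qv _ hr) _; apply: le_trans main1 _.
  by rewrite ler_pdivrMr // ler_peMr ?ler1n // mulr_ge0 // ltW.
have hs' : \sum_j rtr sg ((B j - ((a j)%:C)%:M) *m (B j - ((a j)%:C)%:M)) <= thr * h.
  under eq_bigr do rewrite (rtr_centered _ _ ss).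
  rewrite big_split /= [thr * h]splitr; apply: lerD.
    exact: le_trans (qv _ hs) main1.
  apply: (@le_trans _ _ (\sum_(j < c) (tau * x) ^+ 2)).
    apply: ler_sum => j _; have := cn j.
    rewrite (cabs_tr_diff sr ss (hB j)) ler_pdivrMr // => hj.
    have tx0 : 0 <= tau * x by rewrite mulr_ge0 // ltW.
    rewrite -(real_normK (num_real (rtr sg (B j) - a j))) distrC.
    by rewrite ler_sqr ?nnegrE.
  have -> : \sum_(j < c) (tau * x) ^+ 2 = c%:R * (tau * x) ^+ 2.
    by rewrite sumr_const card_ord [RHS]mulr_natl.
  have c0 : (0 : R) < c.+1%:R by rewrite ltr0n.
  have cc : (c%:R : R) <= c.+1%:R ^+ 2.
    by rewrite -natrX ler_nat (leq_trans (leqnSn c)) // leq_pmulr.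
  have -> : c%:R * (tau * x) ^+ 2 = (c%:R / c.+1%:R ^+ 2) * ((e * x) ^+ 2 * h / 36).
    by rewrite /tau /h; field; rewrite gt_eqF.
  apply: (@le_trans _ _ (1 * ((e * x) ^+ 2 * h / 36))).
    rewrite ler_wpM2r ?ler_pdivrMr ?mul1r ?exprn_gt0 //.
    by rewrite divr_ge0 // mulr_ge0 ?sqr_ge0 // ltW.
  have -> : thr * h / 2 = (e * x) ^+ 2 * h / 32 by rewrite /thr; field.
  rewrite mul1r; apply: ler_wpM2l; first exact: mulr_ge0 (sqr_ge0 _) (ltW h0).
  by clear; lra.
have St : `|entropy r - entropy sg| <= t by move: Sn; rewrite ler_pdivrMr.
have [U [uU cU tU]] :=
  transform_exists N0 hB uW rE dp vp uV sE dq vq t0 St h0 thr0 hr' hs'.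
exists (@Protocol _ N (rdiag (@embez R N)) (rdiag (@embez R N)) U); split.
  by split=> /=; [exact: state_rdiag_embez|exact: state_rdiag_embez|].
split=> /=; first exact: lnN.
  move=> j; apply: le_trans (cU j) _; rewrite /thr sqrtr_sqr ger0_norm ?divr_ge0 //.
  by rewrite mulrC divfK.
apply: le_trans tU _; rewrite /h sqrtr_sqr (ger0_norm (ltW s0)).
have b1 : x * v0 / t ^+ 2 <= e / 16.
  have -> : x * v0 / t ^+ 2 = v0 / (delta ^+ 2 * x).
    by rewrite /t; field; rewrite !gt_eqF.
  rewrite ler_pdivrMr ?mulr_gt0 ?exprn_gt0 //.
  move: n1; rewrite ler_pdivrMr ?mulr_gt0 ?exprn_gt0 // => n1.
  by move: n1; clear; move: (delta ^+ 2) => z; nra.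
have b2 : 2 * s + s ^+ 2 <= e / 16.
  have : s ^+ 2 <= s.
    by rewrite expr2 ler_piMr ?(ltW s0) // /s ler_pdivrMr // mul1r (le_trans e1) // ler1n.
  by rewrite /s; lra.
have b3 : (6 + 8 * t) / ln N.+1%:R <= e / 2.
  have ex1 : 0 < e * x by rewrite mulr_gt0.
  apply: (@le_trans _ _ ((6 + 8 * t) / (e * x))).
    rewrite ler_wpM2l ?lef_pV2 ?posrE ?(lt_le_trans ex1) //.
    by rewrite addr_ge0 // mulr_ge0 // ltW.
  rewrite ler_pdivrMr // /t /delta.
  move: n2; rewrite ler_pdivrMr ?exprn_gt0 // => n2.
  by move: n2; rewrite !expr2; clear; nra.
move: b1 b2 b3; rewrite /x /v0; clear.
move: (_ / t ^+ 2) (2 * s + _) (_ / ln _) => q1 q2 q3; lra.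
Unshelve. all: by end_near.
Qed.

End Asymptotics.

(** * The converse estimates in the limit, and the equivalence *)

Section Converse_limit.
Local Open Scope complex_scope.
Context {R : realType}.
Local Notation C := R[i].

Lemma state_prodst d (rho : nat -> 'M[C]_d) n : (0 < n)%N ->
  (forall i, is_state (rho i)) -> is_state (prodst rho n).
Proof. by case: n => // n _; exact: state_prodst_rec. Qed.

Lemma charge_herm d (A : 'M[C]_d) n : (0 < n)%N ->
  is_hermitian A -> is_hermitian (charge A n).
Proof. by case: n => // n _; exact: charge_rec_herm. Qed.

Lemma charge_bound d (A : 'M[C]_d) n : (0 < n)%N ->
  is_hermitian A -> order_bound (n%:R * opnorm A) (charge A n).
Proof. by case: n => // n _; exact: charge_rec_bound. Qed.

Lemma entropy_transfer_prodst d n K (rho sigma : nat -> 'M[C]_d) (omega' omega : 'M[C]_K)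
  (U : 'M[C]_(d ^ n * K)) (t : R) : (0 < n)%N ->
  (forall i, is_state (rho i)) -> (forall i, is_state (sigma i)) ->
  is_state omega' -> is_state omega -> is_unitary U -> 0 < t ->
  n%:R * (d%:R * 4) / t ^+ 2 <= 8^-1 ->
  trnorm (U *m (prodst rho n *t omega') *m adj U - prodst sigma n *t omega) <= 8^-1 ->
  entropy (prodst sigma n) <= entropy (prodst rho n) + 2 * t + ln K%:R + 1.
Proof.
case: n U => // n U _ hr hs so' so uU t0 vt tn.
have [W [x [uW rE dx vx]]] := prodst_rec_spectral n hr.
have [V [y [uV sE dy vy]]] := prodst_rec_spectral n hs.
exact: (entropy_transfer uU so' so uW rE dx vx uV sE dy vy t0 vt tn).
Qed.

Lemma entropy_diff_near d (rho sigma : nat -> 'M[C]_d) (k : nat -> nat)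
  (omega omega' : forall n, 'M[C]_(k n)) (U : forall n, 'M[C]_(d ^ n * k n)) (e : R) :
  (forall i, is_state (rho i)) -> (forall i, is_state (sigma i)) ->
  (forall n, is_state (omega n)) -> (forall n, is_state (omega' n)) ->
  (forall n, is_unitary (U n)) ->
  (forall eps, 0 < eps -> \forall n \near \oo, ln ((k n)%:R : R) / n%:R <= eps) ->
  (forall eps, 0 < eps -> \forall n \near \oo,
     trnorm (U n *m (prodst rho n *t omega' n) *m adj (U n) - prodst sigma n *t omega n) <= eps) ->
  0 < e -> \forall n \near \oo, entropy (prodst sigma n) - entropy (prodst rho n) <= e * n%:R.
Proof.
move=> hr hs ho ho' hU hk htr e0.
(* The terms [2 * t], [ln K] and 1 are at most [2 delta n], [delta n] and [delta n], together
   [e n]. *)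
pose delta := e / 4; have d0 : 0 < delta by rewrite divr_gt0.
pose v0 : R := d%:R * 4.
near=> n.
have n0 : (0 < n)%N by near: n; exact: nbhs_infty_gt.
have nR : (0 : R) < n%:R by rewrite ltr0n.
have n1 : 8 * v0 / delta ^+ 2 <= n%:R by near: n; exact: nbhs_infty_ger.
have n2 : delta^-1 <= n%:R by near: n; exact: nbhs_infty_ger.
have kn : ln ((k n)%:R : R) / n%:R <= delta by near: n; exact: hk.
have tn : trnorm (U n *m (prodst rho n *t omega' n) *m adj (U n) - prodst sigma n *t omega n)
    <= 8^-1 by near: n; apply: htr; rewrite invr_gt0.
pose t := delta * n%:R; have t0 : 0 < t by rewrite mulr_gt0.
have vt : n%:R * v0 / t ^+ 2 <= 8^-1.
  have -> : n%:R * v0 / t ^+ 2 = v0 / delta ^+ 2 / n%:R.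
    by rewrite /t; field; rewrite !gt_eqF.
  rewrite ler_pdivrMr //; move: n1; rewrite -mulrA; clear.
  by move: (v0 / _) => z; lra.
have := entropy_transfer_prodst n0 hr hs (ho' n) (ho n) (hU n) t0 vt tn.
move: kn n2; rewrite ler_pdivrMr // -[delta^-1]mul1r ler_pdivrMr //.
rewrite /t /delta; clear; move: (entropy _) (entropy _) (ln _) n%:R => S' S l x.
by have -> : e * x = 4 * (e / 4 * x); [field|rewrite [x * _]mulrC; move: (e / 4 * x) => y; lra].
Unshelve. all: by end_near.
Qed.

End Converse_limit.

Theorem theorem7p1 (R : realType) (d c : nat) (A : 'I_c -> 'M[R[i]]_d)
  (rho sigma : nat -> 'M[R[i]]_d) :
  (forall j, is_hermitian (A j)) ->
  (forall i, is_state (rho i)) -> (forall i, is_state (sigma i)) ->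
  asym_equiv A rho sigma <->
  exists (k : nat -> nat) (omega omega' : forall n, 'M[R[i]]_(k n))
         (U : forall n, 'M[R[i]]_(d ^ n * k n)),
    [/\ @subexp_dim R k,
        (forall n, is_state (omega n) /\ is_state (omega' n)),
        sublinear_charges (fun (_ : 'I_c) n => (0 : 'M[R[i]]_(k n))),
        almost_commuting A (fun (_ : 'I_c) n => (0 : 'M[R[i]]_(k n))) U &
        (fun n : nat => trnorm (U n *m (prodst rho n *t omega' n) *m adj (U n)
                                - prodst sigma n *t omega n)) @ \oo --> (0 : R)].
Proof.
move=> hA hr hs.
have lnk_ge0 (k : nat -> nat) (om : forall n, 'M[R[i]]_(k n)) : (forall n, is_state (om n)) ->
    forall n, 0 <= ln ((k n)%:R : R) / n%:R.
  by move=> h n; rewrite divr_ge0 // ln_ge0 // ler1n; exact: state_dim (h n).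
split.
  move=> hAE.
  have [x [vx gx]] := @diagonal_choice R (fun n => protocol (d ^ n)) (fun n => @valid_protocol R (d ^ n))
    (fun e n => good_protocol (fun j => charge (A j) n) (prodst rho n) (prodst sigma n) e n%:R)
    (fun e e' n x => @good_protocol_mono R _ _ _ _ _ e e' n%:R x (ler0n _ _))
    (fun n => valid_protocol_exists (d ^ n))
    (fun e => good_protocol_near hA hr hs hAE).
  exists (fun n => anc (x n)), (fun n => out_state (x n)), (fun n => in_state (x n)),
    (fun n => transf (x n)).
  have so n : is_state (out_state (x n)) by case: (vx n).
  split.
  - apply/cvg0P; first exact: (lnk_ge0 _ (fun n => out_state (x n))).
    move=> e e0; near=> n; rewrite ler_pdivrMr ?ltr0n; last by near: n; exact: nbhs_infty_gt.
    have [] // : good_protocol (fun j => charge (A j) n) (prodst rho n) (prodst sigma n) e n%:R (x n).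
    by near: n; exact: gx.
  - by move=> n; split; case: (vx n).
  - move=> j; have z n : opnorm (0 : 'M[R[i]]_(anc (x n))) / n%:R = 0.
      rewrite (_ : opnorm _ = 0) ?mul0r //; apply/eqP; rewrite eq_le opnorm_ge0 andbT.
      by apply: opnorm_le => //; rewrite mulmx0 subr0; apply: psd_scalar; exact: sqr_ge0.
    by under eq_fun do rewrite z; exact: cvg_cst.
  - split; first by move=> n; case: (vx n).
    move=> j; apply/cvg0P; first by move=> n; rewrite divr_ge0 // opnorm_ge0.
    move=> e e0; near=> n; rewrite /= tensmx0 addr0.
    rewrite ler_pdivrMr ?ltr0n; last by near: n; exact: nbhs_infty_gt.
    have [_ + _] : good_protocol (fun j => charge (A j) n) (prodst rho n) (prodst sigma n) e n%:R (x n).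
      by near: n; exact: gx.
    exact.
  - apply/cvg0P; first by move=> n; exact: trnorm_ge0.
    move=> e e0; near=> n.
    have [] // : good_protocol (fun j => charge (A j) n) (prodst rho n) (prodst sigma n) e n%:R (x n).
    by near: n; exact: gx.
move=> [k [om [om' [U [hk ho _ [hU hc] ht]]]]].
have ho1 n : is_state (om n) by case: (ho n).
have ho2 n : is_state (om' n) by case: (ho n).
have {}hk := (cvg0P (lnk_ge0 k om ho1)).1 hk.
have {}ht := (cvg0P (fun n => trnorm_ge0 _)).1 ht.
have {}hc j := (cvg0P (fun n => divr_ge0 (opnorm_ge0 _) (ler0n _ _))).1 (hc j).
have hU' n : is_unitary (adj (U n)) := unitary_adj (hU n).
have herm_tens_states n (X : 'M[R[i]]_(d ^ n)) (Y : 'M[R[i]]_(k n)) :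
    is_state X -> is_state Y -> is_hermitian (X *t Y).
  by move=> sX sY; exact: herm_tens (state_herm sX) (state_herm sY).
(* Conjugating the error by [adj (U n)] preserves its trace norm and yields, up to sign, the error
   of the reversed protocol, with [om] and [om'] exchanged. *)
have ht' e : 0 < e -> \forall n \near \oo,
    trnorm (adj (U n) *m (prodst sigma n *t om n) *m adj (adj (U n)) - prodst rho n *t om' n) <= e.
  move=> e0; near=> n; have h : trnorm (U n *m (prodst rho n *t om' n) *m adj (U n) -
      prodst sigma n *t om n) <= e by near: n; exact: ht.
  have n0 : (0 < n)%N by near: n; exact: nbhs_infty_gt.
  have hX := herm_tens_states n _ _ (state_prodst n0 hr) (ho2 n).
  have hY := herm_tens_states n _ _ (state_prodst n0 hs) (ho1 n).
  move: hX hY h; set X := prodst rho n *t om' n; set Y := prodst sigma n *t om n.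
  clearbody X Y => hX hY; apply: le_trans.
  have hD : is_hermitian (U n *m X *m adj (U n) - Y) := hermB (herm_conj (U n) hX) hY.
  rewrite -(trnorm_conj (hU' n) hD) -(trnormN (herm_conj (adj (U n)) hD)).
  have -> : - (adj (U n) *m (U n *m X *m adj (U n) - Y) *m adj (adj (U n))) =
      adj (U n) *m Y *m adj (adj (U n)) - X; last exact: lexx.
  rewrite mulmxBr mulmxBl opprB; congr (_ - _).
  by rewrite !mulmxA (proj1 (hU n)) mul1mx adjK -mulmxA (proj1 (hU n)) mulmx1.
have S1 := fun e => @entropy_diff_near R d rho sigma k om om' U e hr hs ho1 ho2 hU hk ht.
have S2 := fun e => @entropy_diff_near R d sigma rho k om' om _ e hs hr ho2 ho1 hU' hk ht'.
split.
  apply/cvg0P; first by move=> n; rewrite divr_ge0.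
  move=> e e0; near=> n; rewrite ler_pdivrMr ?ltr0n; last by near: n; exact: nbhs_infty_gt.
  have [s1 s2] : entropy (prodst sigma n) - entropy (prodst rho n) <= e * n%:R /\
      entropy (prodst rho n) - entropy (prodst sigma n) <= e * n%:R.
    by near: n; exact: filterI (S1 e e0) (S2 e e0).
  by rewrite ler_norml lerNl opprB; apply/andP; split; [exact: s1|exact: s2].
move=> j; apply/cvg0P; first by move=> n; rewrite divr_ge0 // /cabs normc_def /= sqrtr_ge0.
(* The added 1 keeps the divisor positive when the charge vanishes. *)
pose K := opnorm (A j) + 1; have K0 : 0 < K by rewrite ltr_wpDl ?opnorm_ge0.
move=> e e0; have eK : 0 < e / (2 * K) by apply: divr_gt0 => //; exact: mulr_gt0.
have e2 : 0 < e / 2 by exact: divr_gt0.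
near=> n.
have n0 : (0 < n)%N by near: n; exact: nbhs_infty_gt.
have nR : (0 : R) < n%:R by rewrite ltr0n.
have tn : trnorm (U n *m (prodst rho n *t om' n) *m adj (U n) - prodst sigma n *t om n)
    <= e / (2 * K) by near: n; exact: ht.
have cn : opnorm (U n *m (charge (A j) n *t 1%:M + 1%:M *t 0) -
    (charge (A j) n *t 1%:M + 1%:M *t 0) *m U n) / n%:R <= e / 2.
  by near: n; exact: hc.
rewrite tensmx0 addr0 ler_pdivrMr // in cn.
have := charge_transfer (hU n) (state_prodst n0 hr) (state_prodst n0 hs) (ho2 n) (ho1 n)
  (charge_herm n0 (hA j)) (charge_bound n0 (hA j)).
rewrite ler_pdivrMr //; move=> /le_trans; apply.
have -> : e * n%:R = n%:R * K * (e / (2 * K)) + e / 2 * n%:R.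
  by field; rewrite gt_eqF.
apply: lerD => //; apply: ler_pM => //.
- by rewrite mulr_ge0 // opnorm_ge0.
- exact: trnorm_ge0.
- by rewrite ler_wpM2l // lerDl.
Unshelve. all: by end_near.
Qed.
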